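(* The following assignment is a well-defined symmetric monoidal functor $$\mathbf{T}^*\colon\mathbf{OpenErg}\longrightarrow\mathbf{OpenODE}.$$ On objects, it sends a manifold $A$ to the cotangent bundle $\binom{T^*A}{A}$. On 1-cells, it sends the open energy-driven system from $A$ to $B$ represented by a manifold $X$, a reaction $R\colon T^*X\to TX$ and a smooth map $\langle w,E\rangle\colon A\times X\to B\times\mathbb{R}$ to the 1-cell $\binom{T^*A}{A}\to\binom{T^*B}{B}$ of $\mathbf{OpenODE}$ represented by: - the parameter object $\binom{T^*X}{X}$; - the state manifold $X$ with the open ODE $\binom{R}{\mathrm{id}_X}\colon\binom{TX}{X}\leftrightarrows\binom{T^*X}{X}$; - the lens $\binom{T^*w+\mathrm{d}E}{w}\colon\binom{T^*A}{A}\otimes\binom{T^*X}{X}\leftrightarrows\binom{T^*B}{B}$, whose forward map is $w\colon A\times X\to B$ and whose backward map sends $(a,x)\in A\times X$ and $\alpha\in T^*_{w(a,x)}B$ to $$(T_{(a,x)}w)^*(\alpha)+\mathrm{d}E(a,x)\in T^*_{(a,x)}(A\times X)\cong T^*_aA\times T^*_xX.$$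
   Context: All manifolds and maps are smooth. $\mathbf{Mfd}$ is the cartesian monoidal category of smooth manifolds and smooth maps, with unit $\mathbb{R}^0$ and product $\times$. $\mathbf{Mfd}^{\mathrm{iso}}$ is its wide subcategory of diffeomorphisms, with the monoidal structure inherited from $\times$. ''Symmetric monoidal functor'' means strong symmetric monoidal functor. **Reactions.** A reaction on a manifold $X$ is a smooth fibrewise-linear map $R\colon T^*X\to TX$ over $X$, i.e. a global section of the bundle $[T^*X,TX]$ of fibrewise linear maps. A diffeomorphism $i\colon X\to X'$ transports $R$ to the reaction $i_*R$ on $X'$ given by the composite $T^*X'\xrightarrow{T^*i}T^*X\xrightarrow{R}TX\xrightarrow{Ti}TX'$. For reactions $R$ on $X$ and $R'$ on $X'$, the reaction $R\oplus R'$ on $X\times X'$ is $$T^*_{(x,x')}(X\times X')\cong T^*_xX\times T^*_{x'}X'\xrightarrow{R(x)\times R'(x')}T_xX\times T_{x'}X'\cong T_{(x,x')}(X\times X').$$ **The category $\mathbf{OpenErg}$ of open energy-driven systems.** Its objects are smooth manifolds. A 1-cell $A\to B$ is represented by $(X,R,\langle w,E\rangle)$, where $X$ is a manifold, $R$ is a reaction on $X$, and $\langle w,E\rangle\colon A\times X\to B\times\mathbb{R}$ is smooth. $(X,R,\langle w,E\rangle)$ and $(X',R',\langle w',E'\rangle)$ represent the same 1-cell if there is a diffeomorphism $i\colon X\to X'$ with $i_*R=R'$, $w(a,x)=w'(a,i(x))$ and $E(a,x)=E'(a,i(x))$ for all $a,x$. (This is the Kleisli category of the monad $(-)\times\mathbb{R}$,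 induced by the monoid $(\mathbb{R},0,+)$, on the category $\mathbf{OpenReact}$ obtained by omitting the component $E$.) - Composition of $(X,R,\langle w,E\rangle)\colon A\to B$ with $(X',R',\langle w',E'\rangle)\colon B\to C$: the state manifold is $X\times X'$, the reaction is $R\oplus R'$, the output map is $(a,x,x')\mapsto w'(w(a,x),x')$ and the energy is $(a,x,x')\mapsto E(a,x)+E'(w(a,x),x')$. - The identity of $A$ has state manifold $\mathbb{R}^0$, the zero reaction, output map the canonical isomorphism $A\times\mathbb{R}^0\cong A$, and zero energy. - The monoidal product is $\times$ on objects. On 1-cells $(X,R,\langle w,E\rangle)\colon A\to B$ and $(Y,S,\langle v,F\rangle)\colon C\to D$ it is $(X\times Y,R\oplus S,\langle z,G\rangle)\colon A\times C\to B\times D$ with $z(a,c,x,y)=(w(a,x),v(c,y))$ and $G(a,c,x,y)=E(a,x)+F(c,y)$. - The structural isomorphisms are those of $\mathbf{Mfd}$, regarded as 1-cells with state manifold $\mathbb{R}^0$ and zero energy. **Lenses.** A smooth map $p\colon\bar X\to X$ is a submersion if $(Tp)_{\bar x}$ is surjective for every $\bar x\in\bar X$. The category $\mathbf{MfdLens}$ has as objects the submersions $p\colon\bar X\to X$, written $\binom{\bar X}{X}$. A morphism (lens) $\binom{f^\sharp}{f}\colon\binom{\bar X}{X}\leftrightarrows\binom{\bar Y}{Y}$ consists of a smooth map $f\colon X\to Y$ and a smooth map $f^\sharp\colon f^*\bar Y\to\bar X$ over $X$, where $f^*\bar Y=X\times_Y\bar Y$. The composite of $\binom{f^\sharp}{f}\colon\binom{\bar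 X}{X}\leftrightarrows\binom{\bar Y}{Y}$ followed by $\binom{g^\sharp}{g}\colon\binom{\bar Y}{Y}\leftrightarrows\binom{\bar Z}{Z}$ has forward map $x\mapsto g(f(x))$ and backward map $(x,\bar z)\mapsto f^\sharp(x,g^\sharp(f(x),\bar z))$. The symmetric monoidal product is $\binom{\bar X}{X}\otimes\binom{\bar Y}{Y}=\binom{\bar X\times\bar Y}{X\times Y}$, acting on lenses componentwise, with unit $\binom{\mathbb{R}^0}{\mathbb{R}^0}$. $\binom{TX}{X}$ and $\binom{T^*X}{X}$ denote the tangent and cotangent bundle projections. For a diffeomorphism $\varphi\colon X\to X'$, $\binom{T\varphi^{-1}}{\varphi}\colon\binom{TX}{X}\leftrightarrows\binom{TX'}{X'}$ is the lens with forward map $\varphi$ and backward map $(x,v')\mapsto T(\varphi^{-1})(v')$. **The category $\mathbf{OpenODE}$.** Its objects are the objects $\binom{\bar A}{A}$ of $\mathbf{MfdLens}$. A 1-cell $\binom{\bar A}{A}\to\binom{\bar B}{B}$ is represented by data $\left(\binom{\bar P}{P},X,\binom{u^\sharp}{u},\binom{f^\sharp}{f}\right)$, where $\binom{\bar P}{P}$ is an object of $\mathbf{MfdLens}$, $X$ is a manifold, $\binom{u^\sharp}{u}\colon\binom{TX}{X}\leftrightarrows\binom{\bar P}{P}$ is a lens (an open ODE on the parameter) and $\binom{f^\sharp}{f}\colon\binom{\bar A}{A}\otimes\binom{\bar P}{P}\leftrightarrows\binom{\bar B}{B}$ is a lens. Two such data, with primed notation for the second, represent the same 1-cell if there are a diffeomorphism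 $\varphi\colon X\to X'$ and an isomorphism of lenses $g\colon\binom{\bar P}{P}\to\binom{\bar P'}{P'}$ such that $\binom{u^\sharp}{u}$ followed by $g$ equals $\binom{T\varphi^{-1}}{\varphi}$ followed by $\binom{u'^\sharp}{u'}$, and $\binom{f^\sharp}{f}$ equals $\mathrm{id}\otimes g$ followed by $\binom{f'^\sharp}{f'}$. (This is the category obtained by applying the Para construction to the action on $\mathbf{MfdLens}$ of the category of open ODEs $\left(X,\binom{u^\sharp}{u}\right)$, and replacing hom-categories by their sets of isomorphism classes.) - Composition of $(P,X,u,f)\colon A\to B$ with $(P',X',u',f')\colon B\to C$ (bars and $\sharp$'s suppressed): the parameter is $P\otimes P'$, the state manifold is $X\times X'$, the open ODE is $T(X\times X')\cong TX\otimes TX'\xrightarrow{u\otimes u'}P\otimes P'$, and the lens is $A\otimes P\otimes P'\xrightarrow{f\otimes\mathrm{id}}B\otimes P'\xrightarrow{f'}C$. - Identities have the unit as parameter, state manifold $\mathbb{R}^0$, and the canonical isomorphisms as lenses. - The monoidal product is that of $\mathbf{MfdLens}$ on objects. On 1-cells $(P,X,u,f)\colon A\to B$ and $(Q,Y,v,g)\colon C\to D$ it has parameter $P\otimes Q$, state manifold $X\times Y$, open ODE $T(X\times Y)\cong TX\otimes TY\xrightarrow{u\otimes v}P\otimes Q$ and lens $(A\otimes C)\otimes(P\otimes Q)\cong(A\otimes P)\otimes(C\otimes Q)\xrightarrow{f\otimes g}B\otimes D$. - The structural isomorphisms (associator, unitors, symmetry) are those of $\mathbf{MfdLens}$, regarded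 as 1-cells with trivial parameter and state. The symmetric monoidal structure of $\mathbf{T}^*$ is the one induced by the canonical isomorphisms $T^*(A\times A')\cong T^*A\times T^*A'$ and $T^*\mathbb{R}^0\cong\mathbb{R}^0$. *)

(* Defs.v *)
From HB Require Import structures.
From mathcomp Require Import all_boot all_order all_algebra.
From mathcomp Require Import boolp classical_sets functions reals topology.
From mathcomp Require Import normedtype landau derive interval_inference.
Set Implicit Arguments.
Unset Strict Implicit.
Unset Printing Implicit Defensive.
Import Order.TTheory GRing.Theory Num.Theory numFieldNormedType.Exports.
Local Open Scope classical_set_scope.
Local Open Scope ring_scope.

Section Calculus.
Context {R : realType}.

(* Ck k U f: f is of class C^k on U, phrased through iterated directional
   derivatives; U is open wherever this is used. *)
Fixpoint Ck (k n : nat) (U : set 'rV[R]_n) (f : 'rV[R]_n -> R) : Prop :=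
  match k with
  | 0 => forall p, U p -> {for p, continuous f}
  | k'.+1 => (forall p, U p -> differentiable f p) /\
             (forall v, Ck k' U (fun p => 'D_v f p))
  end.

Definition smooth_on (n a b : nat) (U : set 'rV[R]_n)
    (f : 'rV[R]_n -> 'M[R]_(a, b)) : Prop :=
  forall (k : nat) i j, Ck k U (fun p => f p i j).

Lemma is_diff_near0 (V W : normedModType R) (h : V -> W) (p : V) :
  (\forall q \near p, h q = 0) -> is_diff p h 0.
Proof.
move=> h0.
have hp : h p = 0 by apply: (nbhs_singleton h0).
have cd : continuous (0 : V -> W) /\
    h \o shift p = cst (h p) + \0 +o_ 0 id.
  split; first by apply: cst_continuous.
  apply/eqaddoE; rewrite addr0 hp.
  have -> : cst (0 : W) = (0 : V -> W) by [].
  rewrite add0r; apply/eqoP => _/posnumP[e].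
  have : \forall q \near (0 : V), h (q + p) = 0.
    by move: h0; rewrite (near_shift 0 p) subr0; apply: filterS => q /=.
  by apply: filterS => q /= ->; rewrite normr0 mulr_ge0.
have du : 'd h p = \0 :> (V -> W).
  by apply: diff_unique; case: cd.
by apply: DiffDef => //; apply/diff_locallyP; rewrite du; case: cd.
Qed.

Lemma near_eq_differentiable (V W : normedModType R) (f g : V -> W) (p : V) :
  (\forall q \near p, f q = g q) -> differentiable f p -> differentiable g p.
Proof.
move=> fg df.
have -> : g = f + (g - f) by rewrite addrC subrK.
apply: differentiableD => //.
have : is_diff p (g - f) 0.
  by apply: is_diff_near0; apply: filterS fg => q; rewrite /= !fctE => ->; rewrite subrr.
by move=> ?; exact: ex_diff.
Qed.

Section Ck.
Variables (n : nat).
Implicit Types (U W : set 'rV[R]_n) (f g : 'rV[R]_n -> R).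

Lemma Ck_ext k U f g : open U -> (forall p, U p -> f p = g p) ->
  Ck k U f -> Ck k U g.
Proof.
move=> oU; elim: k f g => [|k IH] f g fg /=.
  move=> cf p Up; have nU : nbhs p U by exact: open_nbhs_nbhs.
  have nfg : {near p, f =1 g} by apply: filterS nU => q; exact: fg.
  rewrite /prop_for /continuous_at -(fg p Up).
  by apply: cvg_trans (cf _ Up); exact: near_eq_cvg nfg.
have nfg p : U p -> \forall q \near p, f q = g q.
  by move=> Up; apply: filterS (open_nbhs_nbhs (conj oU Up)) => q; exact: fg.
case=> df Df; split=> [p Up|v].
  exact: near_eq_differentiable (nfg _ Up) (df _ Up).
by apply: IH (Df v) => p Up; apply: near_eq_derive; exact: nfg.
Qed.

Lemma Ck_sub k U W f : W `<=` U -> Ck k U f -> Ck k W f.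
Proof.
move=> WU; elim: k f => [|k IH] f /=; first by move=> cf p /WU; exact: cf.
by case=> df Df; split=> [p /WU|v]; [exact: df|exact: IH].
Qed.

Lemma CkS k U f : Ck k.+1 U f -> Ck k U f.
Proof.
elim: k f => [|k IH] f [df Df].
  by move=> p Up; exact: differentiable_continuous (df _ Up).
by split=> // v; apply: IH; exact: Df.
Qed.

Lemma Ck_cst k U (c : R) : Ck k U (fun=> c).
Proof.
elim: k c => [|k IH] c /=; first by move=> p _; exact: cst_continuous.
split=> [p _|v]; first exact: differentiable_cst.
have -> : (fun p : 'rV[R]_n => 'D_v (fun=> c) p) = (fun=> 0).
  by apply/funext => p; exact: derive_cst.
exact: IH.
Qed.

Lemma CkD k U f g : open U -> Ck k U f -> Ck k U g -> Ck k U (fun p => f p + g p).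
Proof.
move=> oU; elim: k f g => [|k IH] f g /=.
  by move=> cf cg p Up; apply: continuousD; [exact: cf|exact: cg].
move=> [df Df] [dg Dg]; split=> [p Up|v].
  by apply: differentiableD; [exact: df|exact: dg].
apply: Ck_ext (IH _ _ (Df v) (Dg v)) => // p Up.
by rewrite -deriveD //; apply: diff_derivable; [exact: df|exact: dg].
Qed.

Lemma CkM k U f g : open U -> Ck k U f -> Ck k U g -> Ck k U (fun p => f p * g p).
Proof.
move=> oU; elim: k f g => [|k IH] f g.
  by move=> cf cg p Up; apply: continuousM; [exact: cf|exact: cg].
move=> Cf Cg; have [df Df] := Cf; have [dg Dg] := Cg; split=> [p Up|v].
  by apply: differentiableM; [exact: df|exact: dg].
apply: Ck_ext (CkD oU (IH _ _ (CkS Cf) (Dg v)) (IH _ _ (CkS Cg) (Df v))) => // p Up.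
by rewrite deriveM //; apply: diff_derivable; [exact: df|exact: dg].
Qed.

Lemma Ck_sum k U (I : Type) (r : seq I) (P : pred I) (F : I -> 'rV[R]_n -> R) :
  open U -> (forall i, Ck k U (F i)) -> Ck k U (fun p => \sum_(i <- r | P i) F i p).
Proof.
move=> oU CF; elim: r => [|i r IH].
  by apply: Ck_ext (Ck_cst k U 0) => // p _; rewrite big_nil.
case Pi : (P i).
  by apply: Ck_ext (CkD oU (CF i) IH) => // p _; rewrite big_cons Pi.
by apply: Ck_ext IH => // p _; rewrite big_cons Pi.
Qed.

Lemma derive_coord (v p : 'rV[R]_n) i j : 'D_v (fun q : 'rV[R]_n => q i j) p = v i j.
Proof.
have := derive_mx (@derivable_id _ _ p v).
by rewrite derive_id => /matrixP/(_ i j); rewrite mxE => ->.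
Qed.

Lemma Ck_coord k U i j : Ck k U (fun q : 'rV[R]_n => q i j).
Proof.
case: k => [|k]; first by move=> p _; exact: coord_continuous.
split=> [p _|v]; first exact: differentiable_coord.
rewrite (_ : (fun p => _) = (fun=> v i j)); first exact: Ck_cst.
by apply/funext => p; rewrite derive_coord.
Qed.

End Ck.

Lemma differentiable_mxP (V : normedModType R) a b (f : V -> 'M[R]_(a, b)) (p : V) :
  (forall i j, differentiable (fun q => f q i j) p) -> differentiable f p.
Proof.
move=> df.
have -> : f = \sum_(i < a) \sum_(j < b) (fun q => f q i j *: delta_mx i j).
  apply/funext => q; rewrite {1}(matrix_sum_delta (f q)).
  by rewrite !fct_sumE; apply: eq_bigr => i _; rewrite fct_sumE.
apply: differentiable_sum => i; apply: differentiable_sum => j.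
exact: differentiableZl.
Qed.

Lemma open_preimage n m (U : set 'rV[R]_n) (W : set 'rV[R]_m)
    (f : 'rV[R]_n -> 'rV[R]_m) :
  open U -> open W -> (forall p, U p -> {for p, continuous f}) ->
  open (U `&` f @^-1` W).
Proof.
move=> oU oW cf; rewrite openE => p [Up Wp]; apply: filterI.
  exact: open_nbhs_nbhs.
by apply: (cf p Up); exact: open_nbhs_nbhs.
Qed.

Lemma continuous_mxP (T : topologicalType) a b (f : T -> 'M[R]_(a, b)) (p : T) :
  (forall i j, {for p, continuous (fun q => f q i j)}) -> {for p, continuous f}.
Proof.
move=> cf A [B nB BA]; rewrite /= nbhs_filterE.
have : \forall q \near p, forall i j, B i j (f q i j).
  apply: filter_forall => i; apply: filter_forall => j.
  exact: (cf i j _ (nB i j)).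
by apply: filterS => q Bq; exact: BA.
Qed.

Section comp.
Variables (n m : nat).
Implicit Types (U : set 'rV[R]_n) (W : set 'rV[R]_m) (f : 'rV[R]_n -> 'rV[R]_m).

Lemma derive_comp (f : 'rV[R]_n -> 'rV[R]_m) (g : 'rV[R]_m -> R) p v :
  differentiable f p -> differentiable g (f p) ->
  'D_v (g \o f) p =
  \sum_(j < m) 'D_v (fun q => f q 0 j) p * 'D_(delta_mx 0 j) g (f p).
Proof.
move=> df dg; rewrite deriveE; last exact: differentiable_comp.
rewrite diff_comp //= -(deriveE v df).
rewrite derive_mx; last exact: diff_derivable.
set w := (\matrix_(_, _) _); 
have -> : 'd g (f p) w = \sum_j w 0 j * 'd g (f p) (delta_mx 0 j).
  rewrite [in LHS](row_sum_delta w) linear_sum; apply: eq_bigr => j _.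
  by rewrite linearZ.

apply: eq_bigr => j _; by rewrite -deriveE // /w mxE.
Qed.

Lemma Ck_comp k U W f (g : 'rV[R]_m -> R) : open U ->
  (forall p, U p -> W (f p)) ->
  (forall i j, Ck k U (fun p => f p i j)) -> Ck k W g -> Ck k U (fun p => g (f p)).
Proof.
move=> oU UW; elim: k g => [|k IH] g Cf.
  move=> cg p Up; apply: continuous_comp; last exact/cg/UW.
  by apply: continuous_mxP => i j; exact: (Cf i j).
move=> [dg Dg].
have df p : U p -> differentiable f p.
  by move=> Up; apply: differentiable_mxP => i j; case: (Cf i j) => + _; exact.
split=> [p Up|v].
  by apply: differentiable_comp; [exact: df|exact/dg/UW].
apply: (@Ck_ext _ _ _ (fun p => \sum_(j < m) 'D_v (fun q => f q 0 j) p *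
    'D_(delta_mx 0 j) g (f p))) => //.
  by move=> p Up; rewrite -derive_comp //; [exact: df|exact/dg/UW].
apply: Ck_sum => // j; apply: CkM => //; first by case: (Cf 0 j) => _; exact.
apply: (IH (fun q => 'D_(delta_mx 0 j) g q)) (Dg _) => i l.
by apply: CkS; exact: Cf.
Qed.

End comp.

Lemma smooth_on_ext n a b U (f g : 'rV[R]_n -> 'M[R]_(a, b)) :
  open U -> (forall p, U p -> f p = g p) -> smooth_on U f -> smooth_on U g.
Proof. by move=> oU fg sf k i j; apply: Ck_ext (sf k i j) => // p /fg ->. Qed.

Lemma smooth_on_sub n a b U W (f : 'rV[R]_n -> 'M[R]_(a, b)) :
  W `<=` U -> smooth_on U f -> smooth_on W f.
Proof. by move=> WU sf k i j; apply: Ck_sub (sf k i j). Qed.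

Lemma smooth_on_cst n a b U (c : 'M[R]_(a, b)) :
  smooth_on U (fun _ : 'rV[R]_n => c).
Proof. by move=> k i j; exact: Ck_cst. Qed.

Lemma smooth_on_id n U : smooth_on U (@id 'rV[R]_n).
Proof. by move=> k i j; exact: Ck_coord. Qed.

Lemma smooth_onD n a b U (f g : 'rV[R]_n -> 'M[R]_(a, b)) : open U ->
  smooth_on U f -> smooth_on U g -> smooth_on U (fun p => f p + g p).
Proof.
move=> oU sf sg k i j; apply: Ck_ext (CkD oU (sf k i j) (sg k i j)) => // p _.
by rewrite mxE.
Qed.

Lemma smooth_on_mul n a b c U (f : 'rV[R]_n -> 'M[R]_(a, b))
    (g : 'rV[R]_n -> 'M[R]_(b, c)) : open U ->
  smooth_on U f -> smooth_on U g -> smooth_on U (fun p => f p *m g p).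
Proof.
move=> oU sf sg k i j.
apply: (@Ck_ext _ _ _ (fun p => \sum_l f p i l * g p l j)) => //.
  by move=> p _; rewrite mxE.
by apply: Ck_sum => // l; exact: CkM.
Qed.

Lemma smooth_on_tr n a b U (f : 'rV[R]_n -> 'M[R]_(a, b)) : open U ->
  smooth_on U f -> smooth_on U (fun p => (f p)^T).
Proof. by move=> oU sf k i j; apply: Ck_ext (sf k j i) => // p _; rewrite mxE. Qed.

Lemma smooth_on_row n a b c U (f : 'rV[R]_n -> 'M[R]_(a, b))
    (g : 'rV[R]_n -> 'M[R]_(a, c)) : open U ->
  smooth_on U f -> smooth_on U g -> smooth_on U (fun p => row_mx (f p) (g p)).
Proof.
move=> oU sf sg k i j.
by case: (split_ordP j) => l ->; [apply: Ck_ext (sf k i l)|apply: Ck_ext (sg k i l)];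
  move=> // p _; rewrite ?row_mxEl ?row_mxEr.
Qed.

Lemma smooth_on_lsub n a b c U (f : 'rV[R]_n -> 'M[R]_(a, b + c)) : open U ->
  smooth_on U f -> smooth_on U (fun p => lsubmx (f p)).
Proof.
by move=> oU sf k i j; apply: Ck_ext (sf k i (lshift _ j)) => // p _; rewrite mxE.
Qed.

Lemma smooth_on_rsub n a b c U (f : 'rV[R]_n -> 'M[R]_(a, b + c)) : open U ->
  smooth_on U f -> smooth_on U (fun p => rsubmx (f p)).
Proof.
by move=> oU sf k i j; apply: Ck_ext (sf k i (rshift _ j)) => // p _; rewrite mxE.
Qed.

Lemma smooth_on_comp n m a b U W (f : 'rV[R]_n -> 'rV[R]_m)
    (g : 'rV[R]_m -> 'M[R]_(a, b)) : open U -> (forall p, U p -> W (f p)) ->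
  smooth_on U f -> smooth_on W g -> smooth_on U (fun p => g (f p)).
Proof.
move=> oU UW sf sg k i j.
exact: (@Ck_comp _ _ _ _ W _ (fun q => g q i j)).
Qed.

Lemma smooth_on_differentiable n a b U (f : 'rV[R]_n -> 'M[R]_(a, b)) p :
  smooth_on U f -> U p -> differentiable f p.
Proof.
by move=> sf Up; apply: differentiable_mxP => i j; case: (sf 1%N i j) => + _; exact.
Qed.

Lemma smooth_on_continuous n a b U (f : 'rV[R]_n -> 'M[R]_(a, b)) p :
  smooth_on U f -> U p -> {for p, continuous f}.
Proof.
move=> sf Up; apply: differentiable_continuous.
exact: smooth_on_differentiable sf Up.
Qed.

Lemma jacobianE n m (f : 'rV[R]_n -> 'rV[R]_m) p i j : differentiable f p ->
  jacobian f p i j = 'D_(delta_mx 0 i) (fun q => f q 0 j) p.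
Proof.
move=> df.
have := derive_mx (@diff_derivable _ _ _ _ _ (delta_mx 0 i) df).
by rewrite deriveEjacobian // -rowE => /matrixP/(_ 0 j); rewrite !mxE.
Qed.

Lemma smooth_on_jacobian n m U (f : 'rV[R]_n -> 'rV[R]_m) : open U ->
  smooth_on U f -> smooth_on U (fun p => jacobian f p).
Proof.
move=> oU sf k i j.
apply: (@Ck_ext _ _ _ (fun p => 'D_(delta_mx 0 i) (fun q => f q 0 j) p)) => //.
  by move=> p Up; rewrite jacobianE //; exact: smooth_on_differentiable sf Up.
by case: (sf k.+1 0 j) => _; exact.
Qed.

Lemma row_jacobian n m (f : 'rV[R]_n -> 'rV[R]_m) p i : differentiable f p ->
  row i (jacobian f p) = 'D_(delta_mx 0 i) f p.
Proof. by move=> df; rewrite rowE -deriveEjacobian. Qed.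

Lemma jacobian_id n p : jacobian (@id 'rV[R]_n) p = 1%:M.
Proof.
apply/row_matrixP => i; rewrite row_jacobian; last exact: ex_diff.
by rewrite derive_id row1.
Qed.

Lemma jacobian_comp n m l (f : 'rV[R]_n -> 'rV[R]_m) (g : 'rV[R]_m -> 'rV[R]_l) p :
  differentiable f p -> differentiable g (f p) ->
  jacobian (g \o f) p = jacobian f p *m jacobian g (f p).
Proof.
move=> df dg; apply/row_matrixP => i.
rewrite row_jacobian; last exact: differentiable_comp.
rewrite row_mul row_jacobian // -(deriveEjacobian _ dg) deriveE; last exact: differentiable_comp.
rewrite diff_comp //= -(deriveE _ df) -(deriveE _ dg); congr ('D_ _ _ _).
Qed.

Lemma near_eq_jacobian n m (f g : 'rV[R]_n -> 'rV[R]_m) p :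
  (\forall q \near p, f q = g q) -> differentiable f p ->
  jacobian f p = jacobian g p.
Proof.
move=> fg df; apply/row_matrixP => i; 
have dg := near_eq_differentiable fg df.
apply: (etrans (row_jacobian i df)); apply/esym/(etrans (row_jacobian i dg)).
by apply/esym; exact: near_eq_derive fg.
Qed.

Lemma jacobian_linear n m (A : 'M[R]_(n, m)) p : jacobian (mulmxr A) p = A.
Proof.
have c : continuous (mulmxr A : 'rV[R]_n -> 'rV[R]_m).
  move=> q; apply: (@smooth_on_continuous _ _ _ setT) => //.
  apply: smooth_on_mul; [exact: openT|exact: smooth_on_id|exact: smooth_on_cst].
apply/row_matrixP => i; rewrite row_jacobian; last exact: linear_differentiable.
rewrite deriveE; last exact: linear_differentiable.
by rewrite diff_lin //= rowE.
Qed.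

End Calculus.

(* A smooth manifold without boundary, of pure dimension dim, presented by a
   countable atlas (hence second countable).  Chart i is a bijection coord i
   from dom i onto the open set cod i, with inverse icoord i.  The topology is
   the one induced by the charts: no topology on the carrier is assumed, and
   openness of the domains is openness of the overlaps in coordinates.  The
   field separated is the Hausdorff axiom.  The chart chart_at x around x is
   used to write tangent and cotangent vectors at x in coordinates.  The empty
   manifold has an empty set of charts. *)
Record manifold (R : realType) := Manifold {
  carrier :> Type;
  dim : nat;
  chart : countType;
  dom : chart -> set carrier;
  cod : chart -> set 'rV[R]_dim;
  coord : chart -> carrier -> 'rV[R]_dim;
  icoord : chart -> 'rV[R]_dim -> carrier;
  chart_at : carrier -> chart;
  chart_atP : forall x, dom (chart_at x) x;
  coord_cod : forall i x, dom i x -> cod i (coord i x);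
  icoord_dom : forall i p, cod i p -> dom i (icoord i p);
  coordK : forall i x, dom i x -> icoord i (coord i x) = x;
  icoordK : forall i p, cod i p -> coord i (icoord i p) = p;
  overlap_open : forall i j, open (cod i `&` icoord i @^-1` dom j);
  transition_smooth : forall i j,
    smooth_on (cod i `&` icoord i @^-1` dom j) (coord j \o icoord i);
  separated : forall x y : carrier, x <> y ->
    exists P Q, [/\ nbhs (coord (chart_at x) x) P,
      nbhs (coord (chart_at y) y) Q &
      forall z, dom (chart_at x) z -> dom (chart_at y) z ->
        P (coord (chart_at x) z) -> Q (coord (chart_at y) z) -> False]
}.
Arguments dim {R}.
Arguments chart_at {R m}.
Arguments overlap_open {R m} i j.
Arguments transition_smooth {R m} i j.

Section Manifolds.
Context {R : realType}.
Implicit Types X Y Z : manifold R.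

Definition overlap X (i j : chart X) : set 'rV[R]_(dim X) :=
  cod i `&` icoord i @^-1` dom j.

Definition mnbhs X (x : X) (W : set X) : Prop :=
  exists2 P : set 'rV[R]_(dim X), nbhs (coord (chart_at x) x) P &
    forall z, dom (chart_at x) z -> P (coord (chart_at x) z) -> W z.

(* The coordinate expression of f is defined and C^oo near x; in particular f
   is continuous near x. *)
Definition smooth_in X Y (i : chart X) (j : chart Y) (f : X -> Y) (x : X) : Prop :=
  exists U : set 'rV[R]_(dim X), [/\ open U, U (coord i x),
    forall p, U p -> cod i p /\ dom j (f (icoord i p)) &
    smooth_on U (fun p => coord j (f (icoord i p)))].

Definition smooth_at X Y (f : X -> Y) (x : X) : Prop :=
  smooth_in (chart_at x) (chart_at (f x)) f x.

Definition smooth X Y (f : X -> Y) : Prop := forall x, smooth_at f x.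

(* Vectors are rows and T f acts by right multiplication. *)
Definition tmat_in X Y (i : chart X) (j : chart Y) (f : X -> Y) (x : X)
    : 'M[R]_(dim X, dim Y) :=
  jacobian (fun p => coord j (f (icoord i p))) (coord i x).

Definition tmat X Y (f : X -> Y) (x : X) : 'M[R]_(dim X, dim Y) :=
  tmat_in (chart_at x) (chart_at (f x)) f x.

Lemma cod_open X (i : chart X) : open (cod i).
Proof.
have := overlap_open i i; rewrite (_ : _ `&` _ = cod i) //.
by apply/seteqP; split=> [p []|p cp] //; split=> //; exact: icoord_dom.
Qed.

Lemma smooth_in_id X (i j : chart X) (x : X) :
  dom i x -> dom j x -> smooth_in i j id x.
Proof.
move=> ix jx; exists (overlap i j); split.
- exact: overlap_open.
- by split; [exact: coord_cod|rewrite /= coordK].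
- by move=> p [].
- exact: transition_smooth.
Qed.

Lemma smooth_in_comp X Y Z (i : chart X) (j : chart Y) (l : chart Z)
    (f : X -> Y) (g : Y -> Z) x : dom i x ->
  smooth_in i j f x -> smooth_in j l g (f x) -> smooth_in i l (g \o f) x.
Proof.
move=> ix [U [oU Ux Ud Us]] [W [oW Wx Wd Ws]].
pose fh p := coord j (f (icoord i p)).
have oV : open (U `&` fh @^-1` W).
  by apply: open_preimage => // p Up; exact: smooth_on_continuous Us Up.
have fhE p : U p -> icoord j (fh p) = f (icoord i p).
  by move=> Up; rewrite /fh coordK //; case: (Ud p Up).
exists (U `&` fh @^-1` W); split=> //.
- by split=> //; rewrite /= /fh coordK.
- move=> p [Up Wp]; split; first by case: (Ud p Up).
  by rewrite /= -fhE //; case: (Wd _ Wp).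
- apply: (@smooth_on_ext _ _ _ _ _ (fun p => coord l (g (icoord j (fh p))))) => //.
    by move=> p [Up _]; rewrite /= fhE.
  apply: (@smooth_on_comp _ _ _ _ _ _ W fh
    (fun q => coord l (g (icoord j q)))) => //; first by move=> p [].
  by apply: smooth_on_sub Us => p [].
Qed.

Lemma smooth_in_change X Y (i i' : chart X) (j j' : chart Y) (f : X -> Y) x :
  dom i x -> dom i' x -> dom j (f x) -> dom j' (f x) ->
  smooth_in i j f x -> smooth_in i' j' f x.
Proof.
move=> ix i'x jx j'x sf.
have s1 : smooth_in i' j f x.
  exact: (@smooth_in_comp _ _ _ i' i j id f x i'x (smooth_in_id i'x ix) sf).
exact: (@smooth_in_comp _ _ _ i' j j' f id x i'x s1 (smooth_in_id jx j'x)).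
Qed.

Lemma smooth_in_dom X Y (i : chart X) (j : chart Y) (f : X -> Y) x :
  dom i x -> smooth_in i j f x -> dom j (f x).
Proof. by move=> ix [U [oU Ux Ud Us]]; have := (Ud _ Ux).2; rewrite coordK. Qed.

Lemma smooth_in_at X Y (i : chart X) (j : chart Y) (f : X -> Y) x :
  dom i x -> smooth_in i j f x -> smooth_at f x.
Proof.
move=> ix sf; apply: smooth_in_change (sf) => //; try exact: chart_atP.
exact: smooth_in_dom ix sf.
Qed.

Lemma smooth_at_in X Y (i : chart X) (j : chart Y) (f : X -> Y) x :
  dom i x -> dom j (f x) -> smooth_at f x -> smooth_in i j f x.
Proof. by move=> ix jx sf; apply: smooth_in_change sf => //; exact: chart_atP. Qed.

Lemma smooth_at_comp X Y Z (f : X -> Y) (g : Y -> Z) x :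
  smooth_at f x -> smooth_at g (f x) -> smooth_at (g \o f) x.
Proof. by apply: smooth_in_comp; exact: chart_atP. Qed.

Lemma smooth_comp X Y Z (f : X -> Y) (g : Y -> Z) :
  smooth f -> smooth g -> smooth (g \o f).
Proof. by move=> sf sg x; exact: smooth_at_comp. Qed.

Lemma smooth_id X : smooth (@id X).
Proof. by move=> x; apply: smooth_in_id; exact: chart_atP. Qed.

Lemma smooth_in_diff X Y (i : chart X) (j : chart Y) (f : X -> Y) x :
  smooth_in i j f x -> differentiable (fun p => coord j (f (icoord i p))) (coord i x).
Proof. by move=> [U [oU Ux Ud Us]]; exact: smooth_on_differentiable Us Ux. Qed.

Lemma tmat_in_comp X Y Z (i : chart X) (j : chart Y) (l : chart Z)
    (f : X -> Y) (g : Y -> Z) x : dom i x ->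
  smooth_in i j f x -> smooth_in j l g (f x) ->
  tmat_in i l (g \o f) x = tmat_in i j f x *m tmat_in j l g (f x).
Proof.
move=> ix sf sg; have df := smooth_in_diff sf; have dg := smooth_in_diff sg.
have [U [oU Ux Ud Us]] := sf.
pose fh p := coord j (f (icoord i p)); pose gh q := coord l (g (icoord j q)).
have fx : fh (coord i x) = coord j (f x) by rewrite /fh coordK.
have dg' : differentiable gh (fh (coord i x)) by rewrite fx.
have J := @jacobian_comp _ _ _ _ fh gh (coord i x) df dg'.
rewrite fx in J; apply: etrans J.
apply: near_eq_jacobian; last exact: smooth_in_diff (smooth_in_comp ix sf sg).
apply: filterS (open_nbhs_nbhs (conj oU Ux)) => p Up.
by rewrite /= /gh /fh coordK //; case: (Ud p Up).
Qed.

Lemma tmat_in_id X (i : chart X) (x : X) : dom i x -> tmat_in i i id x = 1%:M.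
Proof.
move=> ix; rewrite -(jacobian_id (coord i x)); apply: near_eq_jacobian;
    last exact: smooth_in_diff (smooth_in_id ix ix).
apply: filterS (open_nbhs_nbhs (conj (@cod_open _ i) (coord_cod ix))) => p cp.
by rewrite icoordK.
Qed.

Lemma tmat_in_change X Y (i i' : chart X) (j j' : chart Y) (f : X -> Y) x :
  dom i x -> dom i' x -> dom j (f x) -> dom j' (f x) -> smooth_at f x ->
  tmat_in i' j' f x =
  tmat_in i' i id x *m tmat_in i j f x *m tmat_in j j' id (f x).
Proof.
move=> ix i'x jx j'x sf.
have s1 := smooth_at_in i'x jx sf; have s2 := smooth_at_in ix jx sf.
rewrite -(@tmat_in_comp _ _ _ i' i j id f x i'x (smooth_in_id i'x ix) s2).
exact: (@tmat_in_comp _ _ _ i' j j' f id x i'x s1 (smooth_in_id jx j'x)).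
Qed.

Lemma tmat_comp X Y Z (f : X -> Y) (g : Y -> Z) x :
  smooth_at f x -> smooth_at g (f x) ->
  tmat (g \o f) x = tmat f x *m tmat g (f x).
Proof. by apply: tmat_in_comp; exact: chart_atP. Qed.

Lemma tmat_id X (x : X) : tmat id x = 1%:M.
Proof. by apply: tmat_in_id; exact: chart_atP. Qed.

Lemma mnbhs_chart X (i : chart X) (x : X) (P : set 'rV[R]_(dim X)) :
  dom i x -> nbhs (coord i x) P ->
  mnbhs x [set z | dom i z /\ P (coord i z)].
Proof.
move=> ix nP; have xx := chart_atP x; set j := chart_at x in xx *.
have oO := overlap_open j i.
have Ox : overlap j i (coord j x).
  by split; [exact: coord_cod|rewrite /= coordK].
exists (overlap j i `&` (fun p => coord i (icoord j p)) @^-1` P).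
  apply: filterI; first exact: open_nbhs_nbhs.
  apply: (smooth_on_continuous (transition_smooth j i) Ox).
  by rewrite /= coordK.
by move=> z jz [[_ /=]]; rewrite coordK.
Qed.

Lemma mnbhsS X (x : X) (W W' : set X) : W `<=` W' -> mnbhs x W -> mnbhs x W'.
Proof. by move=> WW [P nP PW]; exists P => // z zx /PW - /(_ zx)/WW. Qed.

Lemma mnbhsI X (x : X) (W W' : set X) :
  mnbhs x W -> mnbhs x W' -> mnbhs x (W `&` W').
Proof.
move=> [P nP PW] [Q nQ QW]; exists (P `&` Q); first exact: filterI.
by move=> z zx [Pz Qz]; split; [exact: PW|exact: QW].
Qed.

Lemma mnbhs_singleton X (x : X) (W : set X) : mnbhs x W -> W x.
Proof.
by move=> [P nP PW]; apply: PW; [exact: chart_atP|exact: nbhs_singleton].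
Qed.

Lemma mnbhs_true X (x : X) : mnbhs x setT.
Proof. by exists setT => //; exact: filterT. Qed.

Lemma mnbhs_in X (i : chart X) (x : X) (W : set X) : dom i x -> mnbhs x W ->
  exists U : set 'rV[R]_(dim X), [/\ open U, U (coord i x), U `<=` cod i &
    forall p, U p -> W (icoord i p)].
Proof.
move=> ix [P nP PW]; set j := chart_at x in nP PW.
have xx : dom j x by exact: chart_atP.
have Ox : overlap i j (coord i x).
  by split; [exact: coord_cod|rewrite /= coordK].
move: nP; rewrite nbhsE => -[Q [oQ Qx] QP].
exists (overlap i j `&` (fun p => coord j (icoord i p)) @^-1` Q); split.
- apply: open_preimage => //; first exact: overlap_open.
  by move=> p Op; exact: smooth_on_continuous (transition_smooth i j) Op.
- by split=> //; rewrite /= coordK.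
- by move=> p [[]].
- by move=> p [[_ jp] Qp]; apply: PW => //; exact: QP.
Qed.

Lemma smooth_at_mnbhs X Y (f : X -> Y) x (W : set Y) :
  smooth_at f x -> mnbhs (f x) W -> mnbhs x (f @^-1` W).
Proof.
move=> [U [oU Ux Ud Us]] [P nP PW].
exists (U `&` (fun p => coord (chart_at (f x)) (f (icoord (chart_at x) p))) @^-1` P).
  apply: filterI; first exact: open_nbhs_nbhs.
  by apply: (smooth_on_continuous Us Ux); rewrite /= coordK //; exact: chart_atP.
move=> z zx [Uz Pz]; have := Ud _ Uz; rewrite coordK // => -[_ fz].
by apply: PW => //; move: Pz; rewrite /preimage /= coordK.
Qed.

Lemma smooth_in_near X Y (i : chart X) (j : chart Y) (f : X -> Y) x : dom i x ->
  smooth_in i j f x -> mnbhs x [set z | dom i z /\ smooth_in i j f z].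
Proof.
move=> ix [U [oU Ux Ud Us]].
apply: mnbhsS (mnbhs_chart ix (open_nbhs_nbhs (conj oU Ux))) => z [iz Uz].
by split=> //; exists U.
Qed.

Lemma smooth_in_ext X Y (i : chart X) (j : chart Y) (f g : X -> Y) x : dom i x ->
  mnbhs x [set z | f z = g z] -> smooth_in i j f x -> smooth_in i j g x.
Proof.
move=> ix /(mnbhs_in ix)[V [oV Vx Vc Vfg]] [U [oU Ux Ud Us]].
have oUV : open (U `&` V) by exact: openI.
exists (U `&` V); split=> //.
  by move=> p [Up Vp]; have := Ud p Up; rewrite -(Vfg p Vp).
apply: (smooth_on_ext oUV _ (smooth_on_sub _ Us)) => [p [_ Vp]|p []//].
by rewrite -(Vfg p Vp).
Qed.

Lemma smooth_at_ext X Y (f g : X -> Y) x :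
  mnbhs x [set z | f z = g z] -> smooth_at f x -> smooth_at g x.
Proof.
move=> fg; have /= fgx := mnbhs_singleton fg.
by rewrite /smooth_at -fgx; apply: smooth_in_ext => //; exact: chart_atP.
Qed.

Lemma tmat_in_ext X Y (i : chart X) (j : chart Y) (f g : X -> Y) x : dom i x ->
  mnbhs x [set z | f z = g z] -> smooth_in i j f x ->
  tmat_in i j f x = tmat_in i j g x.
Proof.
move=> ix /(mnbhs_in ix)[V [oV Vx Vc Vfg]] sf; apply: near_eq_jacobian.
  apply: filterS (open_nbhs_nbhs (conj oV Vx)) => p Vp.
  by rewrite (Vfg p Vp).
exact: smooth_in_diff sf.
Qed.

Section euclid.
Variable n : nat.
Let T := 'rV[R]_n.

Lemma euclid_sep (x y : T) : x <> y -> exists P Q : set T,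
  [/\ nbhs x P, nbhs y Q & forall z, True -> True -> P z -> Q z -> False].
Proof.
move=> /eqP xy.
have /hausdorff_accessible _ := @norm_hausdorff R 'rV[R]_n.
have := @norm_hausdorff R 'rV[R]_n.
rewrite open_hausdorff => /(_ _ _ xy)[[P Q]] /= [Px Qy] [oP oQ PQ0].
exists P, Q; split; [apply: open_nbhs_nbhs; split=> //; exact: set_mem|
  apply: open_nbhs_nbhs; split=> //; exact: set_mem|].
move=> z _ _ Pz Qz; have : (P `&` Q) z by [].
by move/eqP : PQ0 => ->.
Qed.

Lemma euclid_overlap : open ([set: T] `&` id @^-1` [set: T]).
Proof. by rewrite preimage_setT setIT; exact: openT. Qed.

Definition euclid : manifold R :=
  @Manifold R T n unit (fun=> setT) (fun=> setT) (fun=> id) (fun=> id) (fun=> tt)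
    (fun=> I) (fun _ _ _ => I) (fun _ _ _ => I) (fun _ _ _ => erefl)
    (fun _ _ _ => erefl) (fun _ _ => euclid_overlap)
    (fun _ _ => @smooth_on_id R n _) euclid_sep.
End euclid.

Lemma rline_sep (x y : R) : x <> y -> exists P Q : set 'rV[R]_1,
  [/\ nbhs (x%:M : 'rV[R]_1) P, nbhs (y%:M : 'rV[R]_1) Q &
  forall z : R, True -> True -> P z%:M -> Q z%:M -> False].
Proof.
move=> xy; have : (x%:M : 'rV[R]_1) <> y%:M.
  by move=> /matrixP/(_ 0 0); rewrite !mxE.
by move=> /euclid_sep[P [Q [nP nQ PQ]]]; exists P, Q; split=> // z _ _; exact: PQ.
Qed.

Lemma rline_overlap :
  open ([set: 'rV[R]_1] `&` (fun p => p 0 0) @^-1` [set: R]).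
Proof. by rewrite preimage_setT setIT; exact: openT. Qed.

Lemma rlineK (p : 'rV[R]_1) : (p 0 0)%:M = p.
Proof. by apply/rowP => j; rewrite !mxE ord1 eqxx. Qed.

Lemma rlineK' (x : R) : (x%:M : 'rV[R]_1) 0 0 = x.
Proof. by rewrite mxE eqxx. Qed.

Lemma rline_smooth U : smooth_on U (fun p : 'rV[R]_1 => (p 0 0)%:M : 'rV[R]_1).
Proof. by move=> k i j; rewrite (_ : (fun _ => _) = fun p : 'rV[R]_1 => p i j);
  [exact: Ck_coord|apply/funext => p; rewrite rlineK]. Qed.

(* The real line, with carrier R itself. *)
Definition rline : manifold R :=
  @Manifold R R 1 unit (fun=> setT) (fun=> setT) (fun _ x => x%:M)
    (fun _ p => p 0 0) (fun=> tt) (fun=> I) (fun _ _ _ => I) (fun _ _ _ => I)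
    (fun _ x _ => rlineK' x) (fun _ p _ => rlineK p)
    (fun _ _ => rline_overlap) (fun _ _ => @rline_smooth _) rline_sep.

End Manifolds.

Section Constructions.
Context {R : realType}.
Implicit Types X Y Z : manifold R.

Lemma open_lsub n m (P : set 'rV[R]_n) :
  open P -> open ((fun p : 'rV[R]_(n + m) => lsubmx p) @^-1` P).
Proof. by move=> oP; apply: open_comp => // p _; exact: continuous_lsubmx. Qed.

Lemma open_rsub n m (P : set 'rV[R]_m) :
  open P -> open ((fun p : 'rV[R]_(n + m) => rsubmx p) @^-1` P).
Proof. by move=> oP; apply: open_comp => // p _; exact: continuous_rsubmx. Qed.

Lemma nbhs_lsub n m (a : 'rV[R]_n) (b : 'rV[R]_m) (P : set 'rV[R]_n) :
  nbhs a P -> nbhs (row_mx a b) ((fun p : 'rV[R]_(n + m) => lsubmx p) @^-1` P).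
Proof.
by move=> nP; apply: (@continuous_lsubmx R 1 n m (row_mx a b)); rewrite row_mxKl.
Qed.

Lemma nbhs_rsub n m (a : 'rV[R]_n) (b : 'rV[R]_m) (P : set 'rV[R]_m) :
  nbhs b P -> nbhs (row_mx a b) ((fun p : 'rV[R]_(n + m) => rsubmx p) @^-1` P).
Proof.
by move=> nP; apply: (@continuous_rsubmx R 1 n m (row_mx a b)); rewrite row_mxKr.
Qed.

Section product.
Variables X Y : manifold R.
Let n := dim X.
Let m := dim Y.
Let pchart : countType := (chart X * chart Y)%type.
Let pdom (k : pchart) : set (X * Y) := [set z | dom k.1 z.1 /\ dom k.2 z.2].
Let pcod (k : pchart) : set 'rV[R]_(n + m) :=
  [set p | cod k.1 (lsubmx p) /\ cod k.2 (rsubmx p)].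
Let pcoord (k : pchart) (z : X * Y) : 'rV[R]_(n + m) :=
  row_mx (coord k.1 z.1) (coord k.2 z.2).
Let picoord (k : pchart) (p : 'rV[R]_(n + m)) : X * Y :=
  (icoord k.1 (lsubmx p), icoord k.2 (rsubmx p)).

Let poverlapE k l : pcod k `&` picoord k @^-1` pdom l =
  (fun p => lsubmx p) @^-1` (cod k.1 `&` icoord k.1 @^-1` dom l.1) `&`
  (fun p => rsubmx p) @^-1` (cod k.2 `&` icoord k.2 @^-1` dom l.2).
Proof. by apply/seteqP; split=> [p [[? ?] [? ?]]|p [[? ?] [? ?]]]. Qed.

Fact prod_at z : pdom (chart_at z.1, chart_at z.2) z.
Proof. by split; exact: chart_atP. Qed.

Fact prod_coord_cod k z : pdom k z -> pcod k (pcoord k z).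
Proof.
by case=> d1 d2; rewrite /pcoord; split; rewrite /= ?row_mxKl ?row_mxKr; exact: coord_cod.
Qed.

Fact prod_icoord_dom k p : pcod k p -> pdom k (picoord k p).
Proof. by case=> c1 c2; split; exact: icoord_dom. Qed.

Fact prod_coordK k z : pdom k z -> picoord k (pcoord k z) = z.
Proof.
by case: z => x y [/= d1 d2]; rewrite /picoord /pcoord row_mxKl row_mxKr !coordK.
Qed.

Fact prod_icoordK k p : pcod k p -> pcoord k (picoord k p) = p.
Proof.
by case=> c1 c2; rewrite /picoord /pcoord /= !icoordK // hsubmxK.
Qed.

Fact prod_overlap_open k l : open (pcod k `&` picoord k @^-1` pdom l).
Proof.
rewrite poverlapE; apply: openI.
  by apply: open_lsub; exact: overlap_open.
by apply: open_rsub; exact: overlap_open.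
Qed.

Fact prod_transition_smooth k l :
  smooth_on (pcod k `&` picoord k @^-1` pdom l) (pcoord l \o picoord k).
Proof.
have o := @prod_overlap_open k l; apply: smooth_on_row => //=.
- apply: (@smooth_on_comp _ _ _ _ _ _ (cod k.1 `&` icoord k.1 @^-1` dom l.1)
    (fun p => lsubmx p) (coord l.1 \o icoord k.1)) => //.
  + by move=> p [[? _] [? _]].
  + by apply: smooth_on_lsub => //; exact: smooth_on_id.
  + exact: transition_smooth.
- apply: (@smooth_on_comp _ _ _ _ _ _ (cod k.2 `&` icoord k.2 @^-1` dom l.2)
    (fun p => rsubmx p) (coord l.2 \o icoord k.2)) => //.
  + by move=> p [[_ ?] [_ ?]].
  + by apply: smooth_on_rsub => //; exact: smooth_on_id.
  + exact: transition_smooth.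
Qed.

Fact prod_separated (z w : X * Y) : z <> w -> exists P Q,
  [/\ nbhs (pcoord (chart_at z.1, chart_at z.2) z) P,
      nbhs (pcoord (chart_at w.1, chart_at w.2) w) Q &
      forall u, pdom (chart_at z.1, chart_at z.2) u ->
        pdom (chart_at w.1, chart_at w.2) u ->
        P (pcoord (chart_at z.1, chart_at z.2) u) ->
        Q (pcoord (chart_at w.1, chart_at w.2) u) -> False].
Proof.
move=> zw; have [e1|/separated[P [Q [nP nQ PQ]]]] := pselect (z.1 = w.1); last first.
  exists ((fun p => lsubmx p) @^-1` P), ((fun p => lsubmx p) @^-1` Q).
  split; [exact: nbhs_lsub|exact: nbhs_lsub|].
  by move=> u [zu _] [wu _]; rewrite /preimage /= /pcoord !row_mxKl; exact: PQ.
have /separated[P [Q [nP nQ PQ]]] : z.2 <> w.2.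
  by move=> e2; apply: zw; rewrite (surjective_pairing z) e1 e2 -surjective_pairing.
exists ((fun p => rsubmx p) @^-1` P), ((fun p => rsubmx p) @^-1` Q).
split; [exact: nbhs_rsub|exact: nbhs_rsub|].
by move=> u [_ zu] [_ wu]; rewrite /preimage /= /pcoord !row_mxKr; exact: PQ.
Qed.

Definition mprod : manifold R := @Manifold R (X * Y)%type (dim X + dim Y) pchart
  pdom pcod pcoord picoord (fun z => (chart_at z.1, chart_at z.2))
  prod_at prod_coord_cod prod_icoord_dom prod_coordK prod_icoordK
  prod_overlap_open prod_transition_smooth prod_separated.
End product.

(* Transition functions of a vector bundle: cmx g i j x maps fibre coordinates
   over x in chart i to those in chart j. *)
Record cocycle X := Cocycle {
  rank : nat;
  cmx : chart X -> chart X -> X -> 'M[R]_rank;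
  cmx1 : forall i x, dom i x -> cmx i i x = 1%:M;
  cmxM : forall i j l x, dom i x -> dom j x -> dom l x ->
    cmx i j x *m cmx j l x = cmx i l x;
  cmx_smooth : forall i j,
    smooth_on (cod i `&` icoord i @^-1` dom j) (cmx i j \o icoord i)
}.

(* A point (x, v) of the total space is a vector over x whose fibre coordinates
   in the chart chart_at x are v. *)
Section bundle.
Variables (X : manifold R) (g : cocycle X).
Let k := rank g.
Let n := dim X.
Let bdom (i : chart X) : set (X * 'rV[R]_k) := [set z | dom i z.1].
Let bcod (i : chart X) : set 'rV[R]_(n + k) := [set p | cod i (lsubmx p)].
Let bcoord (i : chart X) (z : X * 'rV[R]_k) : 'rV[R]_(n + k) :=
  row_mx (coord i z.1) (z.2 *m cmx g (chart_at z.1) i z.1).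
Let bicoord (i : chart X) (p : 'rV[R]_(n + k)) : X * 'rV[R]_k :=
  let x := icoord i (lsubmx p) in (x, rsubmx p *m cmx g i (chart_at x) x).

Fact bundle_at z : bdom (chart_at z.1) z.
Proof. exact: chart_atP. Qed.

Fact bundle_coord_cod i z : bdom i z -> bcod i (bcoord i z).
Proof. by move=> d; rewrite /bcod /= row_mxKl; exact: coord_cod. Qed.

Fact bundle_icoord_dom i p : bcod i p -> bdom i (bicoord i p).
Proof. by move=> c; exact: icoord_dom. Qed.

Fact bundle_coordK i z : bdom i z -> bicoord i (bcoord i z) = z.
Proof.
case: z => x v; rewrite /bdom /bicoord /bcoord /= row_mxKl row_mxKr => ix.
by rewrite coordK // -mulmxA cmxM ?cmx1 ?mulmx1 //; exact: chart_atP.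
Qed.

Fact bundle_icoordK i p : bcod i p -> bcoord i (bicoord i p) = p.
Proof.
rewrite /bcod /bicoord /bcoord /= => c; rewrite icoordK // -mulmxA.
by rewrite cmxM ?cmx1 ?mulmx1 ?hsubmxK //; try exact: icoord_dom; exact: chart_atP.
Qed.

Let boverlapE i j : bcod i `&` bicoord i @^-1` bdom j =
  (fun p => lsubmx p) @^-1` (cod i `&` icoord i @^-1` dom j).
Proof. by []. Qed.

Fact bundle_overlap_open i j : open (bcod i `&` bicoord i @^-1` bdom j).
Proof. by rewrite boverlapE; apply: open_lsub; exact: overlap_open. Qed.

Fact bundle_transition_smooth i j :
  smooth_on (bcod i `&` bicoord i @^-1` bdom j) (bcoord j \o bicoord i).
Proof.
have o := @bundle_overlap_open i j.
have sl : smooth_on (bcod i `&` bicoord i @^-1` bdom j)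
    (fun p : 'rV[R]_(n + k) => lsubmx p).
  by apply: smooth_on_lsub => //; exact: smooth_on_id.
apply: (@smooth_on_ext _ _ _ _ _ (fun p => row_mx (coord j (icoord i (lsubmx p)))
    (rsubmx p *m cmx g i j (icoord i (lsubmx p))))) => //.
  move=> p [c d]; rewrite /= /bcoord /bicoord /= -mulmxA cmxM //.
    exact: icoord_dom.
  exact: chart_atP.
apply: smooth_on_row => //.
  apply: (@smooth_on_comp _ _ _ _ _ _ _ (fun p : 'rV[R]_(n + k) => lsubmx p)
    (coord j \o icoord i)) (transition_smooth i j) => //.
apply: smooth_on_mul => //.
  by apply: smooth_on_rsub => //; exact: smooth_on_id.
apply: (@smooth_on_comp _ _ _ _ _ _ _ (fun p : 'rV[R]_(n + k) => lsubmx p)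
    (cmx g i j \o icoord i)) (@cmx_smooth _ g i j) => //.
Qed.

Fact bundle_separated (z w : X * 'rV[R]_k) : z <> w -> exists P Q,
  [/\ nbhs (bcoord (chart_at z.1) z) P, nbhs (bcoord (chart_at w.1) w) Q &
      forall u, bdom (chart_at z.1) u -> bdom (chart_at w.1) u ->
        P (bcoord (chart_at z.1) u) -> Q (bcoord (chart_at w.1) u) -> False].
Proof.
case: z w => x v [y u] /= zw.
have [e|/separated[P [Q [nP nQ PQ]]]] := pselect (x = y); last first.
  exists ((fun p => lsubmx p) @^-1` P), ((fun p => lsubmx p) @^-1` Q).
  split; [exact: nbhs_lsub|exact: nbhs_lsub|].
  by move=> t zu wu; rewrite /preimage /= /bcoord !row_mxKl; exact: PQ.
subst y; have /euclid_sep[P [Q [nP nQ PQ]]] : v <> u by move=> e; apply: zw; rewrite e.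
exists ((fun p => rsubmx p) @^-1` P), ((fun p => rsubmx p) @^-1` Q).
split; rewrite /bcoord /= ?cmx1 ?mulmx1; try exact: chart_atP.
- exact: nbhs_rsub.
- exact: nbhs_rsub.
- by move=> t _ _; rewrite /preimage /= !row_mxKr; exact: PQ.
Qed.

Definition bundle : manifold R := @Manifold R (X * 'rV[R]_(rank g))%type
  (dim X + rank g) (chart X) bdom bcod bcoord bicoord (fun z => chart_at z.1)
  bundle_at bundle_coord_cod bundle_icoord_dom bundle_coordK bundle_icoordK
  bundle_overlap_open bundle_transition_smooth bundle_separated.

End bundle.

Section tangent.
Variable X : manifold R.

Fact tangent_cmxM (i j l : chart X) x : dom i x -> dom j x -> dom l x ->
  tmat_in i j id x *m tmat_in j l id x = tmat_in i l id x.
Proof.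
move=> ix jx lx.
by rewrite -(@tmat_in_comp _ _ _ _ i j l id id x) //; exact: smooth_in_id.
Qed.

Fact tangent_cmx_smooth (i j : chart X) :
  smooth_on (cod i `&` icoord i @^-1` dom j)
    ((fun x => tmat_in i j id x) \o icoord i).
Proof.
apply: (@smooth_on_ext _ _ _ _ _ (fun p => jacobian (coord j \o icoord i) p)).
- exact: overlap_open.
- by move=> p [c d]; rewrite /= /tmat_in icoordK.
- by apply: smooth_on_jacobian; [exact: overlap_open|exact: transition_smooth].
Qed.

(* The differential of the change of charts. *)
Definition tangent_cocycle : cocycle X :=
  @Cocycle X (dim X) (fun i j x => tmat_in i j id x) (@tmat_in_id _ X)
    tangent_cmxM tangent_cmx_smooth.

Fact cotangent_cmx1 (i : chart X) x : dom i x -> (tmat_in i i id x)^T = 1%:M.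
Proof. by move=> ix; rewrite tmat_in_id // trmx1. Qed.

Fact cotangent_cmxM (i j l : chart X) x : dom i x -> dom j x -> dom l x ->
  (tmat_in j i id x)^T *m (tmat_in l j id x)^T = (tmat_in l i id x)^T.
Proof. by move=> ix jx lx; rewrite -trmx_mul tangent_cmxM. Qed.

Fact cotangent_cmx_smooth (i j : chart X) :
  smooth_on (cod i `&` icoord i @^-1` dom j)
    ((fun x => (tmat_in j i id x)^T) \o icoord i).
Proof.
have o := overlap_open i j; apply: smooth_on_tr => //.
pose G q := tmat_in j i id (icoord j q).
have H : smooth_on (cod i `&` icoord i @^-1` dom j)
    (fun p => G (coord j (icoord i p))).
  apply: (@smooth_on_comp _ _ _ _ _ _ (cod j `&` icoord j @^-1` dom i)
    (fun p => coord j (icoord i p)) G) => //.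
  - move=> p [c d]; split; first exact: coord_cod.
    by rewrite /preimage /= coordK //; exact: icoord_dom.
  - exact: transition_smooth.
  - exact: tangent_cmx_smooth.
apply: smooth_on_ext o _ H => p [c d].
by rewrite /G coordK.
Qed.

(* Covectors are written in the dual basis, so that the covector xi takes the
   value v *m xi^T on the tangent vector v, and they are pulled back along f by
   right multiplication by the transpose of tmat f. *)
Definition cotangent_cocycle : cocycle X :=
  @Cocycle X (dim X) (fun i j x => (tmat_in j i id x)^T) cotangent_cmx1
    cotangent_cmxM cotangent_cmx_smooth.

Definition tangent : manifold R := bundle tangent_cocycle.
Definition cotangent : manifold R := bundle cotangent_cocycle.

End tangent.

Lemma smooth_at_pair X Y Z (f : X -> Y) (g : X -> Z) x :
  smooth_at f x -> smooth_at g x ->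
  @smooth_at _ X (mprod Y Z) (fun z => (f z, g z)) x.
Proof.
move=> [U [oU Ux Ud Us]] [W [oW Wx Wd Ws]].
have o : open (U `&` W) by exact: openI.
exists (U `&` W); split=> //.
- move=> p [Up Wp]; case: (Ud p Up) => ? ?; case: (Wd p Wp) => ? ?.
  by split.
- by apply: smooth_on_row => //; [apply: smooth_on_sub Us|apply: smooth_on_sub Ws] => p [].
Qed.

Lemma smooth_pair X Y Z (f : X -> Y) (g : X -> Z) :
  smooth f -> smooth g -> @smooth _ X (mprod Y Z) (fun z => (f z, g z)).
Proof. by move=> sf sg x; exact: smooth_at_pair. Qed.

Lemma smooth_fst X Y : @smooth _ (mprod X Y) X fst.
Proof.
move=> z; exists (cod (chart_at z)).
have o : open (cod (chart_at z)) by exact: cod_open.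
split=> //.
- by apply: coord_cod; exact: chart_atP.
- by move=> p c; split=> //; case: c => c _; exact: icoord_dom.
- apply: (@smooth_on_ext _ _ _ _ _ (fun p => lsubmx p)) => //.
    by move=> p [c _]; rewrite /= icoordK.
  by apply: smooth_on_lsub => //; exact: smooth_on_id.
Qed.

Lemma smooth_snd X Y : @smooth _ (mprod X Y) Y snd.
Proof.
move=> z; exists (cod (chart_at z)).
have o : open (cod (chart_at z)) by exact: cod_open.
split=> //.
- by apply: coord_cod; exact: chart_atP.
- by move=> p c; split=> //; case: c => _ c; exact: icoord_dom.
- apply: (@smooth_on_ext _ _ _ _ _ (fun p => rsubmx p)) => //.
    by move=> p [_ c]; rewrite /= icoordK.
  by apply: smooth_on_rsub => //; exact: smooth_on_id.
Qed.

Lemma smooth_cst X Y (y : Y) : @smooth _ X Y (fun=> y).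
Proof.
move=> x; exists (cod (chart_at x)); split.
- exact: cod_open.
- by apply: coord_cod; exact: chart_atP.
- by move=> p c; split=> //; exact: chart_atP.
- exact: smooth_on_cst.
Qed.

Section bundle_smooth.
Variables (X : manifold R) (g : cocycle X).

Lemma bundle_proj_smooth : @smooth _ (bundle g) X fst.
Proof.
move=> z; exists (cod (chart_at z)).
have o : open (cod (chart_at z)) by exact: cod_open.
split=> //.
- by apply: coord_cod; exact: chart_atP.
- by move=> p c; split=> //; exact: icoord_dom.
- apply: (@smooth_on_ext _ _ _ _ _ (fun p => lsubmx p)) => //.
    by move=> p c; rewrite /= icoordK.
  by apply: smooth_on_lsub => //; exact: smooth_on_id.
Qed.

Lemma smooth_at_bundle Z (f : Z -> X) (v : Z -> 'rV[R]_(rank g)) (z : Z) :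
  smooth_at f z ->
  (exists2 U : set 'rV[R]_(dim Z), open U /\ U (coord (chart_at z) z) &
   U `<=` cod (chart_at z) /\
   smooth_on U (fun p => let y := icoord (chart_at z) p in
     v y *m cmx g (chart_at (f y)) (chart_at (f z)) (f y))) ->
  @smooth_at _ Z (bundle g) (fun y => (f y, v y)) z.
Proof.
move=> [U [oU Ux Ud Us]] [W [oW Wx] [Wc Ws]].
have o : open (U `&` W) by exact: openI.
exists (U `&` W); split=> //.
- by move=> p [Up Wp]; case: (Ud p Up) => ? ?.
- by apply: smooth_on_row => //; [apply: smooth_on_sub Us|apply: smooth_on_sub Ws] => p [].
Qed.

End bundle_smooth.

End Constructions.

Section Tangents.
Context {R : realType}.
Implicit Types X Y Z : manifold R.

Lemma jacobian_row n m l (f : 'rV[R]_n -> 'rV[R]_m) (g : 'rV[R]_n -> 'rV[R]_l) p :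
  differentiable f p -> differentiable g p ->
  jacobian (fun q => row_mx (f q) (g q)) p = row_mx (jacobian f p) (jacobian g p).
Proof.
move=> df dg.
have drow : differentiable (fun q => row_mx (f q) (g q)) p.
  apply: differentiable_mxP => i j; rewrite ord1.
  case: (split_ordP j) => t ->.
    rewrite (_ : (fun q => _) = (fun q => f q 0 t)); last first.
      by apply/funext => q; rewrite row_mxEl.
    exact: (differentiable_comp df (differentiable_coord _ _ _)).
  rewrite (_ : (fun q => _) = (fun q => g q 0 t)); last first.
    by apply/funext => q; rewrite row_mxEr.
  exact: (differentiable_comp dg (differentiable_coord _ _ _)).
apply/matrixP => i j; rewrite (jacobianE _ _ drow).
case: (split_ordP j) => t ->.
  rewrite (row_mxEl (jacobian f p) (jacobian g p) i t) (jacobianE i t df).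
  have E : (fun q => row_mx (f q) (g q) 0 (lshift l t)) = (fun q => f q 0 t).
    by apply/funext => q; rewrite row_mxEl.
  exact: (congr1 (fun F : 'rV[R]_n -> R => 'D_(delta_mx 0 i) F p) E).
rewrite (row_mxEr (jacobian f p) (jacobian g p) i t) (jacobianE i t dg).
have E : (fun q => row_mx (f q) (g q) 0 (rshift m t)) = (fun q => g q 0 t).
  by apply/funext => q; rewrite row_mxEr.
exact: (congr1 (fun F : 'rV[R]_n -> R => 'D_(delta_mx 0 i) F p) E).
Qed.

Lemma lsubmx_mul n m k (p : 'M[R]_(k, n + m)) : lsubmx p = p *m col_mx 1%:M 0.
Proof. by rewrite -{2}(hsubmxK p) mul_row_col mulmx1 mulmx0 addr0. Qed.

Lemma rsubmx_mul n m k (p : 'M[R]_(k, n + m)) : rsubmx p = p *m col_mx 0 1%:M.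
Proof. by rewrite -{2}(hsubmxK p) mul_row_col mulmx1 mulmx0 add0r. Qed.

Lemma jacobian_lsub n m (p : 'rV[R]_(n + m)) :
  jacobian (fun q : 'rV[R]_(n + m) => lsubmx q) p = col_mx 1%:M 0.
Proof.
rewrite -[RHS](jacobian_linear (col_mx (1%:M : 'M[R]_n) (0 : 'M[R]_(m, n))) p).
by congr jacobian; apply/funext => q; exact: lsubmx_mul.
Qed.

Lemma jacobian_rsub n m (p : 'rV[R]_(n + m)) :
  jacobian (fun q : 'rV[R]_(n + m) => rsubmx q) p = col_mx 0 1%:M.
Proof.
rewrite -[RHS](jacobian_linear (col_mx (0 : 'M[R]_(n, m)) (1%:M : 'M[R]_m)) p).
by congr jacobian; apply/funext => q; exact: rsubmx_mul.
Qed.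

Lemma tmat_in_pair X Y Z (i : chart X) (j : chart Y) (l : chart Z)
    (f : X -> Y) (g : X -> Z) x : smooth_in i j f x -> smooth_in i l g x ->
  @tmat_in _ X (mprod Y Z) i (j, l) (fun z => (f z, g z)) x =
  row_mx (tmat_in i j f x) (tmat_in i l g x).
Proof.
move=> sf sg.
exact: (jacobian_row (smooth_in_diff sf) (smooth_in_diff sg)).
Qed.

Lemma tmat_pair X Y Z (f : X -> Y) (g : X -> Z) x :
  smooth_at f x -> smooth_at g x ->
  @tmat _ X (mprod Y Z) (fun z => (f z, g z)) x = row_mx (tmat f x) (tmat g x).
Proof. exact: tmat_in_pair. Qed.

Lemma smooth_in_fst X Y (i : chart X) (j : chart Y) (z : mprod X Y) :
  dom i z.1 -> dom j z.2 -> @smooth_in _ (mprod X Y) X (i, j) i fst z.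
Proof. by move=> iz jz; apply: smooth_at_in => //; exact: smooth_fst. Qed.

Lemma smooth_in_snd X Y (i : chart X) (j : chart Y) (z : mprod X Y) :
  dom i z.1 -> dom j z.2 -> @smooth_in _ (mprod X Y) Y (i, j) j snd z.
Proof. by move=> iz jz; apply: smooth_at_in => //; exact: smooth_snd. Qed.

Lemma tmat_in_fst X Y (i : chart X) (j : chart Y) (z : mprod X Y) :
  dom i z.1 -> dom j z.2 ->
  @tmat_in _ (mprod X Y) X (i, j) i fst z = col_mx 1%:M 0.
Proof.
move=> iz jz.
rewrite -[RHS](jacobian_lsub (coord (m := mprod X Y) (i, j) z : 'rV_(dim X + dim Y))).
apply: near_eq_jacobian; last exact: smooth_in_diff (smooth_in_fst iz jz).
have cz : cod (m := mprod X Y) (i, j) (coord (m := mprod X Y) (i, j) z)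
  by exact: coord_cod.
have o : open (cod (m := mprod X Y) (i, j)) by exact: cod_open.
by apply: filterS (open_nbhs_nbhs (conj o cz)) => p [c _]; rewrite /= icoordK.
Qed.

Lemma tmat_in_snd X Y (i : chart X) (j : chart Y) (z : mprod X Y) :
  dom i z.1 -> dom j z.2 ->
  @tmat_in _ (mprod X Y) Y (i, j) j snd z = col_mx 0 1%:M.
Proof.
move=> iz jz.
rewrite -[RHS](jacobian_rsub (coord (m := mprod X Y) (i, j) z : 'rV_(dim X + dim Y))).
apply: near_eq_jacobian; last exact: smooth_in_diff (smooth_in_snd iz jz).
have cz : cod (m := mprod X Y) (i, j) (coord (m := mprod X Y) (i, j) z)
  by exact: coord_cod.
have o : open (cod (m := mprod X Y) (i, j)) by exact: cod_open.
by apply: filterS (open_nbhs_nbhs (conj o cz)) => p [_ c]; rewrite /= icoordK.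
Qed.

Lemma tmat_fst X Y (z : mprod X Y) : @tmat _ (mprod X Y) X fst z = col_mx 1%:M 0.
Proof. by apply: tmat_in_fst; exact: chart_atP. Qed.

Lemma tmat_snd X Y (z : mprod X Y) : @tmat _ (mprod X Y) Y snd z = col_mx 0 1%:M.
Proof. by apply: tmat_in_snd; exact: chart_atP. Qed.

Definition prod_map (S T S' T' : Type) (f : S -> S') (g : T -> T') (z : S * T) :
  S' * T' := (f z.1, g z.2).

Lemma smooth_at_prod_map X Y X' Y' (f : X -> X') (g : Y -> Y') (z : mprod X Y) :
  smooth_at f z.1 -> smooth_at g z.2 ->
  @smooth_at _ (mprod X Y) (mprod X' Y') (prod_map f g) z.
Proof.
move=> sf sg; apply: smooth_at_pair.
  by apply: smooth_at_comp sf; exact: smooth_fst.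
by apply: smooth_at_comp sg; exact: smooth_snd.
Qed.

Lemma smooth_prod_map X Y X' Y' (f : X -> X') (g : Y -> Y') :
  smooth f -> smooth g -> @smooth _ (mprod X Y) (mprod X' Y') (prod_map f g).
Proof. by move=> sf sg z; exact: smooth_at_prod_map. Qed.

Lemma tmat_in_prod_map X Y X' Y' (i : chart X) (j : chart Y) (i' : chart X')
    (j' : chart Y') (f : X -> X') (g : Y -> Y') (z : mprod X Y) :
  dom i z.1 -> dom j z.2 -> smooth_in i i' f z.1 -> smooth_in j j' g z.2 ->
  @tmat_in _ (mprod X Y) (mprod X' Y') (i, j) (i', j') (prod_map f g) z =
  block_mx (tmat_in i i' f z.1) 0 0 (tmat_in j j' g z.2).
Proof.
move=> iz jz sf sg.
have dz : dom (m := mprod X Y) (i, j) z by [].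
have s1 := smooth_in_comp dz (smooth_in_fst iz jz) sf.
have s2 := smooth_in_comp dz (smooth_in_snd iz jz) sg.
rewrite (tmat_in_pair s1 s2).
rewrite (tmat_in_comp dz (smooth_in_fst iz jz) sf).
rewrite (tmat_in_comp dz (smooth_in_snd iz jz) sg).
rewrite tmat_in_fst // tmat_in_snd // !mul_col_mx !mul1mx !mul0mx.
by rewrite block_mxEh.
Qed.

Lemma tmat_prod_map X Y X' Y' (f : X -> X') (g : Y -> Y') (z : mprod X Y) :
  smooth_at f z.1 -> smooth_at g z.2 ->
  @tmat _ (mprod X Y) (mprod X' Y') (prod_map f g) z =
  block_mx (tmat f z.1) 0 0 (tmat g z.2).
Proof. by move=> sf sg; apply: tmat_in_prod_map => //; exact: chart_atP. Qed.

Lemma tmat_in_id_prod X Y (i j : chart (mprod X Y)) (z : mprod X Y) :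
  dom i z -> dom j z ->
  tmat_in i j id z = block_mx (tmat_in i.1 j.1 id z.1) 0 0 (tmat_in i.2 j.2 id z.2).
Proof.
case: i j => i i' [j j'] [iz i'z] [jz j'z].
rewrite -(@tmat_in_prod_map X Y X Y i i' j j' id id z) //; try exact: smooth_in_id.
Qed.

Definition tmap X Y (f : X -> Y) (z : tangent X) : tangent Y :=
  (f z.1, z.2 *m tmat f z.1).

Lemma smooth_at_tmap X Y (f : X -> Y) (z : tangent X) :
  smooth_at f z.1 -> smooth_at (tmap f) z.
Proof.
move=> sf; have sf' := sf; have [U [oU Uz Ud Us]] := sf'.
set i := chart_at z.1 in sf' Uz Ud Us; set j := chart_at (f z.1) in sf' Ud Us.
apply: (@smooth_at_bundle _ Y (tangent_cocycle Y) (tangent X) (fun z => f z.1)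
  (fun z => z.2 *m tmat f z.1)).
  by apply: smooth_at_comp sf; exact: bundle_proj_smooth.
have oV : open ((fun p : 'rV[R]_(dim X + dim X) => lsubmx p) @^-1` U).
  exact: open_lsub.
exists ((fun p : 'rV[R]_(dim X + dim X) => lsubmx p) @^-1` U).
  by split => //; rewrite /preimage /= row_mxKl.
split; first by move=> p /Ud[].
apply: (@smooth_on_ext _ _ _ _ _ (fun p : 'rV[R]_(dim X + dim X) => rsubmx p *m
    jacobian (fun q => coord j (f (icoord i q))) (lsubmx p))) => //.
  move=> p Up; have [ci cj] := Ud _ Up; rewrite /= -!mulmxA; congr (_ *m _).
  have ix : dom i (icoord i (lsubmx p)) by exact: icoord_dom.
  have s' : smooth_in i j f (icoord i (lsubmx p)).
    by exists U; split=> //; rewrite icoordK.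
  have := @tmat_in_change _ X Y _ i _ j f _ (chart_atP _) ix (chart_atP _) cj
    (smooth_in_at ix s').
  by rewrite {1}/tmat_in icoordK // mulmxA => ->.
apply: smooth_on_mul => //.
  by apply: smooth_on_rsub => //; exact: smooth_on_id.
apply: (@smooth_on_comp _ _ _ _ _ _ U (fun p : 'rV[R]_(dim X + dim X) => lsubmx p)
  (fun q => jacobian (fun q => coord j (f (icoord i q))) q)) => //.
  by apply: smooth_on_lsub => //; exact: smooth_on_id.
exact: smooth_on_jacobian.
Qed.

Lemma smooth_tmap X Y (f : X -> Y) : smooth f -> smooth (tmap f).
Proof. by move=> sf z; exact: smooth_at_tmap. Qed.

Section split_merge.
Variables (X Y : manifold R) (g : cocycle X) (h : cocycle Y).
Variable kk : chart (mprod X Y) -> chart (mprod X Y) -> X * Y ->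
  'M[R]_(rank g + rank h).
Hypothesis k1 : forall (i : chart (mprod X Y)) z, dom i z -> kk i i z = 1%:M.
Hypothesis kM : forall (i j l : chart (mprod X Y)) z,
  dom i z -> dom j z -> dom l z -> kk i j z *m kk j l z = kk i l z.
Hypothesis ks : forall (i j : chart (mprod X Y)),
  smooth_on (cod i `&` icoord i @^-1` dom j) (kk i j \o icoord i).
Let K := @Cocycle R (mprod X Y) (rank g + rank h) kk k1 kM ks.
Hypothesis kkE : forall (i j : chart (mprod X Y)) z, dom i z -> dom j z ->
  kk i j z = block_mx (cmx g i.1 j.1 z.1) 0 0 (cmx h i.2 j.2 z.2).

Lemma mul_row_block n m (a b : nat) (u : 'rV[R]_n) (v : 'rV[R]_m)
  (A : 'M[R]_(n, a)) (B : 'M[R]_(m, b)) :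
  row_mx u v *m block_mx A 0 0 B = row_mx (u *m A) (v *m B).
Proof. by rewrite mul_row_block !mulmx0 addr0 add0r. Qed.

(* The chart of X * Y at (x, y) is the product of the charts at x and at y, so
   a vector over (x, y) is the concatenation of its two components. *)
Definition bsplit (u : (X * Y) * 'rV[R]_(rank g + rank h)) :
  (X * 'rV[R]_(rank g)) * (Y * 'rV[R]_(rank h)) :=
  ((u.1.1, lsubmx u.2), (u.1.2, rsubmx u.2)).

Definition bmerge (u : (X * 'rV[R]_(rank g)) * (Y * 'rV[R]_(rank h))) :
  (X * Y) * 'rV[R]_(rank g + rank h) :=
  ((u.1.1, u.2.1), row_mx u.1.2 u.2.2).

Lemma bsplit_smooth :
  @smooth _ (bundle K) (mprod (bundle g) (bundle h)) bsplit.
Proof.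
move=> z; set i := chart_at z.1.
have sb : @smooth_at _ (bundle K) (mprod X Y) fst z by exact: bundle_proj_smooth.
have oV : open ((fun p : 'rV[R]_(dim (mprod X Y) + rank K) => lsubmx p) @^-1` cod i).
  by apply: open_lsub; exact: cod_open.
have Vz : cod i (lsubmx (coord (m := bundle K) i z)).
  have -> : lsubmx (coord (m := bundle K) i z) = coord i z.1 by exact: row_mxKl.
  by apply: coord_cod; exact: chart_atP.
apply: (@smooth_at_pair _ (bundle K) (bundle g) (bundle h)
  (fun z => (z.1.1, lsubmx z.2)) (fun z => (z.1.2, rsubmx z.2))).
- apply: (@smooth_at_bundle _ X g (bundle K) (fun z => z.1.1) (fun z => lsubmx z.2)).
    exact: (smooth_at_comp sb (@smooth_fst _ X Y _)).
  exists ((fun p : 'rV[R]_(dim (mprod X Y) + rank K) => lsubmx p) @^-1` cod i) => //.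
  split=> //.
  apply: (@smooth_on_ext _ _ _ _ _ (fun p : 'rV[R]_(dim (mprod X Y) + rank K) =>
    lsubmx (rsubmx p : 'rV[R]_(rank g + rank h)))) => //.
    move=> p cp /=; set x := icoord i.1 _; set y := icoord i.2 _.
    have [d1 d2] : dom i (x, y) by exact: (icoord_dom cp).
    rewrite kkE //; last exact: (@chart_atP _ (mprod X Y) (x, y)).
    rewrite -[X in X *m block_mx _ _ _ _]hsubmxK mul_row_block row_mxKl -mulmxA.
    by rewrite cmxM ?cmx1 ?mulmx1 //; exact: chart_atP.
  by apply: smooth_on_lsub => //; apply: smooth_on_rsub => //; exact: smooth_on_id.
- apply: (@smooth_at_bundle _ Y h (bundle K) (fun z => z.1.2) (fun z => rsubmx z.2)).
    exact: (smooth_at_comp sb (@smooth_snd _ X Y _)).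
  exists ((fun p : 'rV[R]_(dim (mprod X Y) + rank K) => lsubmx p) @^-1` cod i) => //.
  split=> //.
  apply: (@smooth_on_ext _ _ _ _ _ (fun p : 'rV[R]_(dim (mprod X Y) + rank K) =>
    rsubmx (rsubmx p : 'rV[R]_(rank g + rank h)))) => //.
    move=> p cp /=; set x := icoord i.1 _; set y := icoord i.2 _.
    have [d1 d2] : dom i (x, y) by exact: (icoord_dom cp).
    rewrite kkE //; last exact: (@chart_atP _ (mprod X Y) (x, y)).
    rewrite -[X in X *m block_mx _ _ _ _]hsubmxK mul_row_block row_mxKr -mulmxA.
    by rewrite cmxM ?cmx1 ?mulmx1 //; exact: chart_atP.
  by apply: smooth_on_rsub => //; apply: smooth_on_rsub => //; exact: smooth_on_id.
Qed.

Lemma bmerge_smooth :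
  @smooth _ (mprod (bundle g) (bundle h)) (bundle K) bmerge.
Proof.
move=> z; set c := chart_at z.
have oc : open (cod c) by exact: cod_open.
apply: (@smooth_at_bundle _ (mprod X Y) K (mprod (bundle g) (bundle h))
  (fun u => (u.1.1, u.2.1)) (fun u => row_mx u.1.2 u.2.2)).
  apply: (@smooth_at_prod_map (bundle g) (bundle h) X Y fst fst z).
    exact: bundle_proj_smooth.
  exact: bundle_proj_smooth.
exists (cod c); first by split=> //; apply: coord_cod; exact: chart_atP.
split=> //.
pose pl (p : 'rV[R]_(dim (bundle g) + dim (bundle h))) :
  'rV[R]_(dim X + rank g) := lsubmx p.
pose pr (p : 'rV[R]_(dim (bundle g) + dim (bundle h))) :
  'rV[R]_(dim Y + rank h) := rsubmx p.
apply: (@smooth_on_ext _ _ _ _ _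
    (fun p => row_mx (rsubmx (pl p)) (rsubmx (pr p)))) => //.
  move=> p [c1 c2].
  pose x := icoord (m := X) c.1 (lsubmx (pl p)).
  pose y := icoord (m := Y) c.2 (lsubmx (pr p)).
  have d1 : dom (m := X) c.1 x := icoord_dom c1.
  have d2 : dom (m := Y) c.2 y := icoord_dom c2.
  have := kkE (@chart_atP _ (mprod X Y) (x, y))
    (conj d1 d2 : dom (m := mprod X Y) c (x, y)).
  rewrite /= -/pl -/pr -/x -/y => ->.
  rewrite mul_row_block -!mulmxA (cmxM (x:=x) g d1 (chart_atP x) d1).
  by rewrite (cmxM (x:=y) h d2 (chart_atP y) d2) !cmx1 // !mulmx1.
have sl : smooth_on (cod c) pl by apply: smooth_on_lsub => //; exact: smooth_on_id.
have sr : smooth_on (cod c) pr by apply: smooth_on_rsub => //; exact: smooth_on_id.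
by apply: smooth_on_row => //; exact: smooth_on_rsub.
Qed.

End split_merge.

Definition tsplit X Y : tangent (mprod X Y) -> mprod (tangent X) (tangent Y) :=
  @bsplit X Y (tangent_cocycle X) (tangent_cocycle Y).
Definition tmerge X Y : mprod (tangent X) (tangent Y) -> tangent (mprod X Y) :=
  @bmerge X Y (tangent_cocycle X) (tangent_cocycle Y).
Definition csplit X Y :
    cotangent (mprod X Y) -> mprod (cotangent X) (cotangent Y) :=
  @bsplit X Y (cotangent_cocycle X) (cotangent_cocycle Y).
Definition cmerge X Y :
    mprod (cotangent X) (cotangent Y) -> cotangent (mprod X Y) :=
  @bmerge X Y (cotangent_cocycle X) (cotangent_cocycle Y).

Lemma cotangent_block X Y (i j : chart (mprod X Y)) (z : mprod X Y) :
  dom i z -> dom j z ->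
  (tmat_in j i id z)^T =
  block_mx (tmat_in j.1 i.1 id z.1)^T 0 0 (tmat_in j.2 i.2 id z.2)^T.
Proof. by move=> iz jz; rewrite tmat_in_id_prod // tr_block_mx !trmx0. Qed.

Lemma tsplit_smooth X Y : smooth (@tsplit X Y).
Proof.
exact: (@bsplit_smooth X Y (tangent_cocycle X) (tangent_cocycle Y)
  (fun i j x => tmat_in i j id x) (@tmat_in_id _ (mprod X Y))
  (@tangent_cmxM _ (mprod X Y)) (@tangent_cmx_smooth _ (mprod X Y))
  (@tmat_in_id_prod X Y)).
Qed.

Lemma tmerge_smooth X Y : smooth (@tmerge X Y).
Proof.
exact: (@bmerge_smooth X Y (tangent_cocycle X) (tangent_cocycle Y)
  (fun i j x => tmat_in i j id x) (@tmat_in_id _ (mprod X Y))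
  (@tangent_cmxM _ (mprod X Y)) (@tangent_cmx_smooth _ (mprod X Y))
  (@tmat_in_id_prod X Y)).
Qed.

Lemma csplit_smooth X Y : smooth (@csplit X Y).
Proof.
exact: (@bsplit_smooth X Y (cotangent_cocycle X) (cotangent_cocycle Y)
  (fun i j x => (tmat_in j i id x)^T) (@cotangent_cmx1 _ (mprod X Y))
  (@cotangent_cmxM _ (mprod X Y)) (@cotangent_cmx_smooth _ (mprod X Y))
  (@cotangent_block X Y)).
Qed.

Lemma cmerge_smooth X Y : smooth (@cmerge X Y).
Proof.
exact: (@bmerge_smooth X Y (cotangent_cocycle X) (cotangent_cocycle Y)
  (fun i j x => (tmat_in j i id x)^T) (@cotangent_cmx1 _ (mprod X Y))
  (@cotangent_cmxM _ (mprod X Y)) (@cotangent_cmx_smooth _ (mprod X Y))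
  (@cotangent_block X Y)).
Qed.

End Tangents.

Section Systems.
Context {R : realType}.
Implicit Types X Y Z A B C D : manifold R.

(* R^0 *)
Definition R0 : manifold R := @euclid R 0.

Definition submersion X Y (p : X -> Y) : Prop :=
  smooth p /\
  forall x (u : 'rV[R]_(dim Y)), exists v : 'rV[R]_(dim X), v *m tmat p x = u.

Record diffeo X Y := Diffeo {
  dfun :> X -> Y;
  dinv : Y -> X;
  dfun_smooth : smooth dfun;
  dinv_smooth : smooth dinv;
  dfunK : cancel dfun dinv;
  dinvK : cancel dinv dfun
}.

Lemma smooth_rline_add X (f g : X -> R) :
  @smooth _ X rline f -> @smooth _ X rline g ->
  @smooth _ X rline (fun x => f x + g x).
Proof.
move=> sf sg x; have [U [oU Ux Ud Us]] := sf x; have [W [oW Wx Wd Ws]] := sg x.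
have o : open (U `&` W) by exact: openI.
exists (U `&` W); split=> //; first by move=> p [/Ud[c _] _].
apply: (@smooth_on_ext _ _ _ _ _ (fun p =>
  (f (icoord (chart_at x) p))%:M + (g (icoord (chart_at x) p))%:M)) => //.
  by move=> p _; rewrite -raddfD.
by apply: smooth_onD => //; [apply: smooth_on_sub Us|apply: smooth_on_sub Ws] => p [].
Qed.

Record reaction X := Reaction {
  react :> cotangent X -> tangent X;
  react_smooth : smooth react;
  react_over : forall z : cotangent X, (react z).1 = z.1;
  react_linear : forall (x : X) (a : R) (xi eta : 'rV[R]_(dim X)),
    (react (x, a *: xi + eta)).2 = a *: (react (x, xi)).2 + (react (x, eta)).2
}.

(* T^*f on the fibre of T^*Y over f x. *)
Definition copull X Y (f : X -> Y) (x : X) (xi : 'rV[R]_(dim Y)) : cotangent X :=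
  (x, xi *m (tmat f x)^T).

(* i_* S = T, evaluated on the covectors at i x; used for diffeomorphisms i. *)
Definition transports X Y (i : X -> Y) (S : reaction X) (T : reaction Y) : Prop :=
  forall (x : X) (xi : 'rV[R]_(dim Y)), T (i x, xi) = tmap i (S (copull i x xi)).

Section zero_section.
Variables (X Z : manifold R) (g : cocycle X).
Lemma smooth_zero_section (f : Z -> X) :
  smooth f -> @smooth _ Z (bundle g) (fun z => (f z, 0)).
Proof.
move=> sf z; apply: (@smooth_at_bundle _ X g Z f (fun=> 0)); first exact: sf.
have oc : open (cod (chart_at z)) by exact: cod_open.
exists (cod (chart_at z)); first by split=> //; apply: coord_cod; exact: chart_atP.
split=> //; apply: smooth_on_ext oc _ (smooth_on_cst _ 0) => p _.
by rewrite /= mul0mx.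
Qed.
End zero_section.

Section zero_reaction.
Variable X : manifold R.
Definition zero_react (z : cotangent X) : tangent X := (z.1, 0).
Fact zero_react_smooth : smooth zero_react.
Proof. by apply: smooth_zero_section; exact: bundle_proj_smooth. Qed.
Fact zero_react_linear (x : X) (a : R) (xi eta : 'rV[R]_(dim X)) :
  (zero_react (x, a *: xi + eta)).2 =
  a *: (zero_react (x, xi)).2 + (zero_react (x, eta)).2.
Proof. by rewrite /= scaler0 addr0. Qed.
Definition zero_reaction : reaction X :=
  @Reaction X zero_react zero_react_smooth (fun=> erefl) zero_react_linear.
End zero_reaction.

Section sum_reaction.
Variables (X Y : manifold R) (S : reaction X) (T : reaction Y).
Definition sum_react (z : cotangent (mprod X Y)) : tangent (mprod X Y) :=
  tmerge (prod_map S T (csplit z)).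
Fact sum_react_smooth : smooth sum_react.
Proof.
have sp := @smooth_prod_map _ (cotangent X) (cotangent Y) (tangent X) (tangent Y)
  S T (@react_smooth _ S) (@react_smooth _ T).
exact: (smooth_comp (smooth_comp (@csplit_smooth _ X Y) sp) (@tmerge_smooth _ X Y)).
Qed.
Fact sum_react_over z : (sum_react z).1 = z.1.
Proof.
case: z => -[x y] xi; rewrite /sum_react /tmerge /csplit /bmerge /bsplit /prod_map /=.
by rewrite !react_over.
Qed.
Fact sum_react_linear (x : mprod X Y) (a : R) (xi eta : 'rV[R]_(dim (mprod X Y))) :
  (sum_react (x, a *: xi + eta)).2 =
  a *: (sum_react (x, xi)).2 + (sum_react (x, eta)).2.
Proof.
rewrite /sum_react /tmerge /csplit /bmerge /bsplit /prod_map /=.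
rewrite !linearP /= !react_linear.
by rewrite scale_row_mx add_row_mx.
Qed.
Definition sum_reaction : reaction (mprod X Y) :=
  @Reaction (mprod X Y) sum_react sum_react_smooth sum_react_over sum_react_linear.
End sum_reaction.

Record lens_object := LensObject {
  total : manifold R;
  base : manifold R;
  lproj : total -> base;
  lproj_subm : submersion lproj
}.
Arguments lproj : clear implicits.

(* Smoothness of a map defined on a subset: it extends locally to a smooth map
   on the ambient manifold.  On a pullback along a submersion, which is an
   embedded submanifold of the product, these are the smooth maps. *)
Definition smooth_on_subset X Y (S : X -> Prop) (h : {x : X | S x} -> Y) : Prop :=
  forall s : {x : X | S x}, exists2 F : X -> Y, smooth_at F (sval s) &
    mnbhs (sval s) [set x | forall Sx : S x, h (exist _ x Sx) = F x].

Definition pullback (X Yt Yb : manifold R) (f : X -> Yb) (p : Yt -> Yb) : Type :=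
  {z : mprod X Yt | f z.1 = p z.2}.

Record lens (P Q : lens_object) := Lens {
  fwd : base P -> base Q;
  bwd : pullback fwd (lproj Q) -> total P;
  fwd_smooth : smooth fwd;
  bwd_smooth : smooth_on_subset bwd;
  bwd_over : forall s, lproj P (bwd s) = (sval s).1
}.
Arguments bwd {P Q} l s.
Arguments bwd_smooth {P Q} l s.
Arguments bwd_over {P Q} l s.
Arguments fwd_smooth {P Q} l x.

Definition lens_eq (P Q : lens_object) (l m : lens P Q) : Prop :=
  (forall x, fwd l x = fwd m x) /\
  (forall z h k, bwd l (exist _ z h) = bwd m (exist _ z k)).

Lemma bwd_ext (P Q : lens_object) (l : lens P Q) s t :
  sval s = sval t -> bwd l s = bwd l t.
Proof.
by case: s t => z h [w k] /= e; subst w; congr (bwd l (exist _ z _)); exact: Prop_irrelevance.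
Qed.

Section lens_comp.
Variables (P Q S : lens_object) (l : lens P Q) (m : lens Q S).

Definition lens_comp_bwd
    (s : pullback (fwd m \o fwd l) (lproj S)) : total P :=
  let t : pullback (fwd m) (lproj S) :=
    exist _ (fwd l (sval s).1, (sval s).2) (proj2_sig s) in
  bwd l (exist _ ((sval s).1, bwd m t) (esym (bwd_over m t))).

Fact lens_comp_bwd_smooth : smooth_on_subset lens_comp_bwd.
Proof.
case=> z h.
pose t : pullback (fwd m) (lproj S) := exist _ (fwd l z.1, z.2) h.
pose u : pullback (fwd l) (lproj Q) :=
  exist _ (z.1, bwd m t) (esym (bwd_over m t)).
have [G sG nG] := bwd_smooth m t; have [F sF nF] := bwd_smooth l u.
have Gt : bwd m t = G (sval t) := mnbhs_singleton nG _.
pose k (w : mprod (base P) (total S)) : mprod (base Q) (total S) := (fwd l w.1, w.2).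
have sk : smooth k.
  apply: smooth_pair; last exact: smooth_snd.
  by apply: smooth_comp (fwd_smooth l); exact: smooth_fst.
pose k' (w : mprod (base P) (total S)) : mprod (base P) (total Q) := (w.1, G (k w)).
have sk' : smooth_at k' z.
  apply: smooth_at_pair; first exact: smooth_fst.
  by apply: smooth_at_comp sG; exact: sk.
have k'z : k' z = sval u by rewrite /k' /u /= Gt.
exists (fun w => F (k' w)).
  by apply: (@smooth_at_comp _ _ _ _ k' F) => //=; rewrite k'z.
have n1 := smooth_at_mnbhs (sk z) nG.
rewrite -k'z in nF; have n2 := smooth_at_mnbhs sk' nF.
apply: mnbhsS (mnbhsI n1 n2) => w [w1 w2] Sw.
rewrite /lens_comp_bwd /=.
have e := w1 Sw; have Gw : fwd l w.1 = lproj Q (G (k w)) by rewrite -e bwd_over.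
rewrite -(w2 Gw); apply: bwd_ext.
exact: (congr1 (pair w.1) e).
Qed.

Definition lens_comp : lens P S :=
  @Lens P S (fwd m \o fwd l) lens_comp_bwd
    (smooth_comp (fwd_smooth l) (fwd_smooth m)) lens_comp_bwd_smooth
    (fun s => bwd_over l _).
End lens_comp.

(* The lens with forward map f and backward map (x, z) |-> b z. *)
Section lens_of_maps.
Variables (P Q : lens_object) (f : base P -> base Q) (b : total Q -> total P).
Hypothesis fs : smooth f.
Hypothesis bs : smooth b.
Hypothesis over : forall x z, f x = lproj Q z -> lproj P (b z) = x.

Definition maps_bwd (s : pullback f (lproj Q)) : total P := b (sval s).2.

Fact maps_bwd_smooth : smooth_on_subset maps_bwd.
Proof.
move=> s; exists (fun z => b z.2).
  apply: (@smooth_at_comp _ (mprod (base P) (total Q)) (total Q) (total P) snd b).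
    exact: smooth_snd.
  exact: bs.
by exists setT => //; exact: filterT.
Qed.

Definition lens_of_maps : lens P Q :=
  @Lens P Q f maps_bwd fs maps_bwd_smooth (fun s => over (proj2_sig s)).
End lens_of_maps.

Fact id_over (P : lens_object) (x : base P) (z : total P) : x = lproj P z -> lproj P z = x.
Proof. by []. Qed.

Definition lens_id (P : lens_object) : lens P P :=
  lens_of_maps (smooth_id (X := base P)) (smooth_id (X := total P)) (@id_over P).

Section tensor_obj.
Variables P Q : lens_object.
Fact tensor_subm :
  @submersion (mprod (total P) (total Q)) (mprod (base P) (base Q))
    (prod_map (lproj P) (lproj Q)).
Proof.
have [sp up] := lproj_subm P; have [sq uq] := lproj_subm Q.
split; first exact: smooth_prod_map.
move=> z u.
have [v1 e1] := up z.1 (lsubmx (u : 'rV[R]_(dim (base P) + dim (base Q)))).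
have [v2 e2] := uq z.2 (rsubmx (u : 'rV[R]_(dim (base P) + dim (base Q)))).
exists (row_mx v1 v2); rewrite tmat_prod_map; [|exact: sp|exact: sq].
by rewrite mul_row_block e1 e2 hsubmxK.
Qed.
Definition tensor : lens_object :=
  @LensObject (mprod (total P) (total Q)) (mprod (base P) (base Q)) _ tensor_subm.
End tensor_obj.

Fact unit_subm : @submersion R0 R0 id.
Proof.
split; first exact: smooth_id.
by move=> x u; exists u; rewrite tmat_id mulmx1.
Qed.
Definition lens_unit : lens_object := LensObject unit_subm.

Section tensor_lens.
Variables (P Q P' Q' : lens_object) (l : lens P Q) (m : lens P' Q').

Definition tensor_bwd
    (s : @pullback (base (tensor P P')) (total (tensor Q Q')) (base (tensor Q Q'))
       (prod_map (fwd l) (fwd m)) (lproj (tensor Q Q'))) : total (tensor P P') :=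
  (bwd l (exist _ ((sval s).1.1, (sval s).2.1) (congr1 fst (proj2_sig s))),
   bwd m (exist _ ((sval s).1.2, (sval s).2.2) (congr1 snd (proj2_sig s)))).

Fact tensor_bwd_smooth : smooth_on_subset tensor_bwd.
Proof.
move=> [z h].
pose Z := mprod (base (tensor P P')) (total (tensor Q Q')).
pose k1 (w : Z) : mprod (base P) (total Q) := (w.1.1, w.2.1).
pose k2 (w : Z) : mprod (base P') (total Q') := (w.1.2, w.2.2).
have sk1 : smooth k1.
  apply: (@smooth_prod_map _ (base (tensor P P')) (total (tensor Q Q')) _ _ fst fst);
  exact: smooth_fst.
have sk2 : smooth k2.
  apply: (@smooth_prod_map _ (base (tensor P P')) (total (tensor Q Q')) _ _ snd snd);
  exact: smooth_snd.
have [F sF nF] := bwd_smooth l (exist _ (k1 z) (congr1 fst h)).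
have [G sG nG] := bwd_smooth m (exist _ (k2 z) (congr1 snd h)).
exists (fun w => (F (k1 w), G (k2 w)) : total (tensor P P')).
  apply: smooth_at_pair.
    by apply: (@smooth_at_comp _ _ _ _ k1 F) => //; exact: sk1.
  by apply: (@smooth_at_comp _ _ _ _ k2 G) => //; exact: sk2.
apply: mnbhsS (mnbhsI (smooth_at_mnbhs (sk1 z) nF) (smooth_at_mnbhs (sk2 z) nG)).
move=> w [w1 w2] Sw.
exact: (f_equal2 pair (w1 (congr1 fst Sw)) (w2 (congr1 snd Sw))).
Qed.

Fact tensor_bwd_over s : lproj (tensor P P') (tensor_bwd s) = (sval s).1.
Proof.
by case: s => -[[x x'] [y y']] h; rewrite /tensor_bwd /= /prod_map /= !bwd_over.
Qed.

Definition tensor_lens : lens (tensor P P') (tensor Q Q') :=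
  @Lens (tensor P P') (tensor Q Q') (prod_map (fwd l) (fwd m)) tensor_bwd
    (smooth_prod_map (fwd_smooth l) (fwd_smooth m))
    tensor_bwd_smooth tensor_bwd_over.
End tensor_lens.

End Systems.

Arguments lens_object R : clear implicits.
Arguments lproj {R} l.
Arguments bwd {R P Q} l s.
Arguments bwd_smooth {R P Q} l s.
Arguments bwd_over {R P Q} l s.
Arguments fwd_smooth {R P Q} l x.
Arguments smooth_fst {R} X Y x.
Arguments smooth_snd {R} X Y x.
Arguments smooth_pair {R X Y Z f g}.
Arguments R0 {R}.
Arguments lens_unit {R}.

Section Structure.
Context {R : realType}.
Implicit Types (X Y Z A B C D : manifold R) (P Q S : lens_object R).

Lemma tmat_bundle_proj X (g : cocycle X) (z : bundle g) :
  @tmat _ (bundle g) X fst z = col_mx 1%:M 0.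
Proof.
rewrite -[RHS](jacobian_lsub (coord (chart_at z) z : 'rV_(dim X + rank g))).
apply: near_eq_jacobian; last exact: smooth_in_diff (bundle_proj_smooth z).
have cz : cod (chart_at z) (coord (chart_at z) z) by apply: coord_cod; exact: chart_atP.
have o : open (cod (chart_at z)) by exact: cod_open.
by apply: filterS (open_nbhs_nbhs (conj o cz)) => p c; rewrite /= icoordK.
Qed.

Lemma bundle_proj_subm X (g : cocycle X) : @submersion _ (bundle g) X fst.
Proof.
split; first exact: bundle_proj_smooth.
move=> z u; exists (row_mx u 0); rewrite tmat_bundle_proj.
by rewrite mul_row_col mulmx1 mul0mx addr0.
Qed.

Definition tangent_lens_object X : lens_object R :=
  @LensObject _ (tangent X) X fst (bundle_proj_subm _).
Definition cotangent_lens_object X : lens_object R :=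
  @LensObject _ (cotangent X) X fst (bundle_proj_subm _).

Definition passoc (S T U : Type) (z : S * T * U) : S * (T * U) :=
  (z.1.1, (z.1.2, z.2)).
Definition passoc_inv (S T U : Type) (z : S * (T * U)) : S * T * U :=
  (z.1, z.2.1, z.2.2).
Definition pswap (S T : Type) (z : S * T) : T * S := (z.2, z.1).
Definition pinter (S T U V : Type) (z : (S * T) * (U * V)) : (S * U) * (T * V) :=
  ((z.1.1, z.2.1), (z.1.2, z.2.2)).

Lemma smooth_passoc X Y Z :
  @smooth _ (mprod (mprod X Y) Z) (mprod X (mprod Y Z)) (@passoc X Y Z).
Proof.
have s1 := smooth_comp (smooth_fst (mprod X Y) Z) (smooth_fst X Y).
have s2 := smooth_comp (smooth_fst (mprod X Y) Z) (smooth_snd X Y).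
exact: (smooth_pair s1 (smooth_pair s2 (smooth_snd _ _))).
Qed.

Lemma smooth_passoc_inv X Y Z :
  @smooth _ (mprod X (mprod Y Z)) (mprod (mprod X Y) Z) (@passoc_inv X Y Z).
Proof.
have s1 := smooth_comp (smooth_snd X (mprod Y Z)) (smooth_fst Y Z).
have s2 := smooth_comp (smooth_snd X (mprod Y Z)) (smooth_snd Y Z).
exact: (smooth_pair (smooth_pair (smooth_fst _ _) s1) s2).
Qed.

Lemma smooth_pswap X Y : @smooth _ (mprod X Y) (mprod Y X) (@pswap X Y).
Proof. exact: (smooth_pair (smooth_snd _ _) (smooth_fst _ _)). Qed.

Lemma smooth_pinter X Y Z W :
  @smooth _ (mprod (mprod X Y) (mprod Z W)) (mprod (mprod X Z) (mprod Y W))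
    (@pinter X Y Z W).
Proof.
have s11 := smooth_comp (smooth_fst (mprod X Y) (mprod Z W)) (smooth_fst X Y).
have s12 := smooth_comp (smooth_fst (mprod X Y) (mprod Z W)) (smooth_snd X Y).
have s21 := smooth_comp (smooth_snd (mprod X Y) (mprod Z W)) (smooth_fst Z W).
have s22 := smooth_comp (smooth_snd (mprod X Y) (mprod Z W)) (smooth_snd Z W).
exact: (smooth_pair (smooth_pair s11 s21) (smooth_pair s12 s22)).
Qed.

Lemma smooth_lunit_inv X : @smooth _ X (mprod R0 X) (fun x => (0 : R0, x)).
Proof. exact: (smooth_pair (smooth_cst (X := X) (Y := R0) 0) (smooth_id (X := X))). Qed.
Lemma smooth_runit_inv X : @smooth _ X (mprod X R0) (fun x => (x, 0 : R0)).
Proof. exact: (smooth_pair (smooth_id (X := X)) (smooth_cst (X := X) (Y := R0) 0)). Qed.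

Lemma R0E (x y : @R0 R) : x = y.
Proof. by rewrite (thinmx0 x) (thinmx0 y). Qed.

Fact assoc_over P Q S (x : base (tensor (tensor P Q) S))
    (z : total (tensor P (tensor Q S))) :
  passoc x = lproj (tensor P (tensor Q S)) z ->
  lproj (tensor (tensor P Q) S) (passoc_inv z) = x.
Proof. by case: x z => [[? ?] ?] [? [? ?]] [-> -> ->]. Qed.
Definition lens_assoc P Q S : lens (tensor (tensor P Q) S) (tensor P (tensor Q S)) :=
  @lens_of_maps _ (tensor (tensor P Q) S) (tensor P (tensor Q S)) _ _
    (@smooth_passoc _ _ _) (@smooth_passoc_inv _ _ _) (@assoc_over P Q S).

Fact assoc_inv_over P Q S (x : base (tensor P (tensor Q S)))
    (z : total (tensor (tensor P Q) S)) :
  passoc_inv x = lproj (tensor (tensor P Q) S) z ->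
  lproj (tensor P (tensor Q S)) (passoc z) = x.
Proof. by case: x z => [? [? ?]] [[? ?] ?] [-> -> ->]. Qed.
Definition lens_assoc_inv P Q S :
    lens (tensor P (tensor Q S)) (tensor (tensor P Q) S) :=
  @lens_of_maps _ (tensor P (tensor Q S)) (tensor (tensor P Q) S) _ _
    (@smooth_passoc_inv _ _ _) (@smooth_passoc _ _ _)
    (@assoc_inv_over P Q S).

Fact lunit_over P (x : base (tensor lens_unit P)) (z : total P) :
  x.2 = lproj P z -> lproj (tensor lens_unit P) (0 : R0, z) = x.
Proof. by case: x => x y /= ->; congr pair; exact: R0E. Qed.
Definition lens_lunit P : lens (tensor lens_unit P) P :=
  @lens_of_maps _ (tensor lens_unit P) P _ _
    (smooth_snd R0 (base P)) (@smooth_lunit_inv (total P)) (@lunit_over P).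

Fact runit_over P (x : base (tensor P lens_unit)) (z : total P) :
  x.1 = lproj P z -> lproj (tensor P lens_unit) (z, 0 : R0) = x.
Proof. by case: x => x y /= ->; congr pair; exact: R0E. Qed.
Definition lens_runit P : lens (tensor P lens_unit) P :=
  @lens_of_maps _ (tensor P lens_unit) P _ _
    (smooth_fst (base P) R0) (@smooth_runit_inv (total P)) (@runit_over P).

Fact braid_over P Q (x : base (tensor P Q)) (z : total (tensor Q P)) :
  pswap x = lproj (tensor Q P) z -> lproj (tensor P Q) (pswap z) = x.
Proof. by case: x z => ? ? [? ?] [-> ->]. Qed.
Definition lens_braid P Q : lens (tensor P Q) (tensor Q P) :=
  @lens_of_maps _ (tensor P Q) (tensor Q P) _ _
    (@smooth_pswap _ _) (@smooth_pswap _ _) (@braid_over P Q).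

Fact inter_over P Q S T (x : base (tensor (tensor P Q) (tensor S T)))
    (z : total (tensor (tensor P S) (tensor Q T))) :
  pinter x = lproj (tensor (tensor P S) (tensor Q T)) z ->
  lproj (tensor (tensor P Q) (tensor S T)) (pinter z) = x.
Proof. by case: x z => [[? ?] [? ?]] [[? ?] [? ?]] [-> -> -> ->]. Qed.
Definition lens_interchange P Q S T :
    lens (tensor (tensor P Q) (tensor S T)) (tensor (tensor P S) (tensor Q T)) :=
  @lens_of_maps _ (tensor (tensor P Q) (tensor S T))
    (tensor (tensor P S) (tensor Q T)) _ _ (@smooth_pinter _ _ _ _) (@smooth_pinter _ _ _ _)
    (@inter_over P Q S T).

Fact tangent_lens_over X Y (f : diffeo X Y) (x : base (tangent_lens_object X))
    (z : total (tangent_lens_object Y)) :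
  f x = lproj (tangent_lens_object Y) z ->
  lproj (tangent_lens_object X) (tmap (dinv f) z) = x.
Proof. by case: z => y v /= <-; rewrite dfunK. Qed.
Definition tangent_lens X Y (f : diffeo X Y) :
    lens (tangent_lens_object X) (tangent_lens_object Y) :=
  @lens_of_maps _ (tangent_lens_object X) (tangent_lens_object Y) f (tmap (dinv f))
    (@dfun_smooth _ _ _ f) (smooth_tmap (@dinv_smooth _ _ _ f)) (@tangent_lens_over X Y f).

Fact tangent_prod_over X Y (x : base (tangent_lens_object (mprod X Y)))
    (z : total (tensor (tangent_lens_object X) (tangent_lens_object Y))) :
  x = lproj (tensor (tangent_lens_object X) (tangent_lens_object Y)) z ->
  lproj (tangent_lens_object (mprod X Y)) (tmerge z) = x.
Proof. by move=> ->. Qed.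
(* T(X * Y) ~ TX (x) TY over the identity of X * Y. *)
Definition lens_tangent_prod X Y : lens (tangent_lens_object (mprod X Y))
    (tensor (tangent_lens_object X) (tangent_lens_object Y)) :=
  @lens_of_maps _ (tangent_lens_object (mprod X Y))
    (tensor (tangent_lens_object X) (tangent_lens_object Y)) id (@tmerge _ X Y)
    (smooth_id (X := mprod X Y)) (@tmerge_smooth _ X Y) (@tangent_prod_over X Y).

Fact cotangent_prod_over X Y
    (x : base (tensor (cotangent_lens_object X) (cotangent_lens_object Y)))
    (z : total (cotangent_lens_object (mprod X Y))) :
  x = lproj (cotangent_lens_object (mprod X Y)) z ->
  lproj (tensor (cotangent_lens_object X) (cotangent_lens_object Y)) (csplit z) = x.
Proof. by move=> ->; case: z => -[]. Qed.
(* T^*X (x) T^*Y ~ T^*(X * Y) over the identity of X * Y. *)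
Definition lens_cotangent_prod X Y :
    lens (tensor (cotangent_lens_object X) (cotangent_lens_object Y))
      (cotangent_lens_object (mprod X Y)) :=
  @lens_of_maps _ (tensor (cotangent_lens_object X) (cotangent_lens_object Y))
    (cotangent_lens_object (mprod X Y)) id (@csplit _ X Y)
    (smooth_id (X := mprod X Y)) (@csplit_smooth _ X Y) (@cotangent_prod_over X Y).

Fact tangent_unit_over (x : base (tangent_lens_object R0)) (z : total lens_unit) :
  x = lproj lens_unit z -> lproj (tangent_lens_object R0) ((z, 0) : tangent R0) = x.
Proof. by move=> ->. Qed.
Definition lens_tangent_unit : lens (tangent_lens_object R0) lens_unit :=
  @lens_of_maps _ (tangent_lens_object R0) lens_unit id (fun z => (z, 0) : tangent R0)
    (smooth_id (X := R0)) (smooth_zero_section _ (smooth_id (X := R0)))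
    tangent_unit_over.

Fact cotangent_unit_over (x : base lens_unit) (z : total (cotangent_lens_object R0)) :
  x = lproj (cotangent_lens_object R0) z -> lproj lens_unit z.1 = x.
Proof. by move=> ->. Qed.
Definition lens_cotangent_unit : lens lens_unit (cotangent_lens_object R0) :=
  @lens_of_maps _ lens_unit (cotangent_lens_object R0) id fst
    (smooth_id (X := R0)) (@bundle_proj_smooth _ _ _)
    cotangent_unit_over.

Definition lens_inverse P Q (l : lens P Q) (m : lens Q P) : Prop :=
  lens_eq (lens_comp l m) (lens_id P) /\ lens_eq (lens_comp m l) (lens_id Q).

Record ode_cell (P Q : lens_object R) := OdeCell {
  oparam : lens_object R;
  ostate : manifold R;
  oode : lens (tangent_lens_object ostate) oparam;
  olens : lens (tensor P oparam) Q
}.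

Definition ode_eq P Q (c d : ode_cell P Q) : Prop :=
  exists (phi : diffeo (ostate c) (ostate d)) (g : lens (oparam c) (oparam d))
         (g' : lens (oparam d) (oparam c)),
    [/\ lens_inverse g g',
        lens_eq (lens_comp (oode c) g) (lens_comp (tangent_lens phi) (oode d)) &
        lens_eq (olens c) (lens_comp (tensor_lens (lens_id P) g) (olens d))].

Definition ode_comp P Q S (c : ode_cell P Q) (d : ode_cell Q S) : ode_cell P S :=
  @OdeCell P S (tensor (oparam c) (oparam d)) (mprod (ostate c) (ostate d))
    (lens_comp (lens_tangent_prod (ostate c) (ostate d))
               (tensor_lens (oode c) (oode d)))
    (lens_comp (lens_assoc_inv P (oparam c) (oparam d))
       (lens_comp (tensor_lens (olens c) (lens_id (oparam d))) (olens d))).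

(* A lens as a 1-cell with trivial parameter and state. *)
Definition ode_of_lens P Q (l : lens P Q) : ode_cell P Q :=
  @OdeCell P Q lens_unit R0 lens_tangent_unit (lens_comp (lens_runit P) l).

Definition ode_id P : ode_cell P P :=
  @OdeCell P P lens_unit R0 lens_tangent_unit (lens_runit P).

Definition ode_tensor P Q P' Q' (c : ode_cell P Q) (d : ode_cell P' Q') :
    ode_cell (tensor P P') (tensor Q Q') :=
  @OdeCell (tensor P P') (tensor Q Q') (tensor (oparam c) (oparam d))
    (mprod (ostate c) (ostate d))
    (lens_comp (lens_tangent_prod (ostate c) (ostate d))
               (tensor_lens (oode c) (oode d)))
    (lens_comp (lens_interchange P P' (oparam c) (oparam d))
               (tensor_lens (olens c) (olens d))).

(* The smooth map <w, E> into B * R is given by its components eout = w and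
   energy = E. *)
Record erg_cell A B := ErgCell {
  estate : manifold R;
  ereact : reaction estate;
  eout : mprod A estate -> B;
  energy : mprod A estate -> R;
  eout_smooth : smooth eout;
  energy_smooth : @smooth _ (mprod A estate) rline energy
}.
Arguments eout {A B} e z.
Arguments energy {A B} e z.

Definition erg_eq A B (c d : erg_cell A B) : Prop :=
  exists i : diffeo (estate c) (estate d),
    [/\ transports i (ereact c) (ereact d),
        forall a x, eout c (a, x) = eout d (a, i x) &
        forall a x, energy c (a, x) = energy d (a, i x)].

Section erg_comp.
Variables (A B C : manifold R) (c : erg_cell A B) (d : erg_cell B C).
Let X := mprod A (mprod (estate c) (estate d)).
Let left (z : X) : mprod A (estate c) := (z.1, z.2.1).
Let right (z : X) : mprod B (estate d) := (eout c (z.1, z.2.1), z.2.2).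
Let sleft : smooth left.
Proof.
apply: smooth_pair; first exact: smooth_fst.
exact: (smooth_comp (smooth_snd A (mprod (estate c) (estate d)))
  (smooth_fst (estate c) (estate d))).
Qed.
Let sright : smooth right.
Proof.
apply: smooth_pair; first exact: (smooth_comp sleft (@eout_smooth _ _ c)).
exact: (smooth_comp (smooth_snd A (mprod (estate c) (estate d)))
  (smooth_snd (estate c) (estate d))).
Qed.
Fact erg_comp_out_smooth :
  @smooth _ X C (fun z => eout d (eout c (z.1, z.2.1), z.2.2)).
Proof. exact: (smooth_comp sright (@eout_smooth _ _ d)). Qed.
Fact erg_comp_energy_smooth : @smooth _ X rline
  (fun z => energy c (z.1, z.2.1) + energy d (eout c (z.1, z.2.1), z.2.2)).
Proof.
exact: (smooth_rline_add (smooth_comp sleft (@energy_smooth _ _ c))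
  (smooth_comp sright (@energy_smooth _ _ d))).
Qed.
Definition erg_comp : erg_cell A C :=
  @ErgCell A C (mprod (estate c) (estate d)) (sum_reaction (ereact c) (ereact d))
    _ _ erg_comp_out_smooth erg_comp_energy_smooth.
End erg_comp.

(* A smooth map as a 1-cell with state R^0, zero reaction and zero energy. *)
Section erg_of_map.
Variables (A B : manifold R) (f : A -> B).
Hypothesis fs : smooth f.
Fact erg_of_map_energy_smooth : @smooth _ (mprod A R0) rline (fun=> 0).
Proof. exact: (@smooth_cst _ (mprod A R0) rline 0). Qed.
Definition erg_of_map : erg_cell A B :=
  @ErgCell A B R0 (zero_reaction R0) (fun z => f z.1) (fun=> 0)
    (smooth_comp (smooth_fst A R0) fs) erg_of_map_energy_smooth.
End erg_of_map.

Definition erg_id A : erg_cell A A := erg_of_map (smooth_id (X := A)).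

Section erg_tensor.
Variables (A B C D : manifold R) (c : erg_cell A B) (d : erg_cell C D).
Let X := mprod (mprod A C) (mprod (estate c) (estate d)).
Let left (z : X) : mprod A (estate c) := (z.1.1, z.2.1).
Let right (z : X) : mprod C (estate d) := (z.1.2, z.2.2).
Let sleft : smooth left.
Proof.
exact: (@smooth_prod_map _ (mprod A C) (mprod (estate c) (estate d)) _ _ fst fst
  (smooth_fst _ _) (smooth_fst _ _)).
Qed.
Let sright : smooth right.
Proof.
exact: (@smooth_prod_map _ (mprod A C) (mprod (estate c) (estate d)) _ _ snd snd
  (smooth_snd _ _) (smooth_snd _ _)).
Qed.
Fact erg_tensor_out_smooth : @smooth _ X (mprod B D)
  (fun z => (eout c (z.1.1, z.2.1), eout d (z.1.2, z.2.2))).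
Proof.
exact: (smooth_pair (smooth_comp sleft (@eout_smooth _ _ c))
  (smooth_comp sright (@eout_smooth _ _ d))).
Qed.
Fact erg_tensor_energy_smooth : @smooth _ X rline
  (fun z => energy c (z.1.1, z.2.1) + energy d (z.1.2, z.2.2)).
Proof.
exact: (smooth_rline_add (smooth_comp sleft (@energy_smooth _ _ c))
  (smooth_comp sright (@energy_smooth _ _ d))).
Qed.
Definition erg_tensor : erg_cell (mprod A C) (mprod B D) :=
  @ErgCell (mprod A C) (mprod B D) (mprod (estate c) (estate d))
    (sum_reaction (ereact c) (ereact d)) _ _
    erg_tensor_out_smooth erg_tensor_energy_smooth.
End erg_tensor.

Section Tstar.
Variables (A B : manifold R) (c : erg_cell A B).
Let X := estate c.
Let w := eout c.
Let E := energy c.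

Fact react_lens_over (x : base (tangent_lens_object X))
    (z : total (cotangent_lens_object X)) :
  x = lproj (cotangent_lens_object X) z ->
  lproj (tangent_lens_object X) (ereact c z) = x.
Proof. by move=> ->; exact: react_over. Qed.

Definition react_lens : lens (tangent_lens_object X) (cotangent_lens_object X) :=
  @lens_of_maps _ (tangent_lens_object X) (cotangent_lens_object X) id (ereact c)
    (smooth_id (X := X)) (@react_smooth _ _ (ereact c)) react_lens_over.

(* tmat E is the column of partial derivatives of E; dE is its covector. *)
Definition dE (z : mprod A X) : 'rV[R]_(dim (mprod A X)) :=
  (@tmat _ (mprod A X) rline E z)^T.

Definition pull_dE (z : mprod A X) (alpha : 'rV[R]_(dim B)) : cotangent (mprod A X) :=
  (z, alpha *m (tmat w z)^T + dE z).

Definition Tstar_bwd (s : @pullback _ (mprod A X) (cotangent B) B w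
    (lproj (cotangent_lens_object B))) :
  total (tensor (cotangent_lens_object A) (cotangent_lens_object X)) :=
  csplit (pull_dE (sval s).1 (sval s).2.2).

Fact Tstar_bwd_over s :
  lproj (tensor (cotangent_lens_object A) (cotangent_lens_object X)) (Tstar_bwd s) =
  (sval s).1.
Proof. by case: s => -[[a x] [b beta]]. Qed.

Fact Tstar_bwd_smooth : smooth_on_subset Tstar_bwd.
Proof.
case=> -[z0 [b0 beta0]] h /=; rewrite /= in h; subst b0.
pose Z := mprod (mprod A X) (cotangent B).
pose i := chart_at z0; pose j := chart_at (w z0).
have sw : smooth_at w z0 := @eout_smooth _ _ c z0.
have sE : @smooth_at _ (mprod A X) rline E z0 := @energy_smooth _ _ c z0.
pose v (y : Z) : 'rV[R]_(dim (mprod A X)) :=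
  y.2.2 *m cmx (cotangent_cocycle B) (chart_at y.2.1) j y.2.1 *m
    (tmat_in (chart_at y.1) j w y.1)^T + dE y.1.
have key y (beta : 'rV[R]_(dim B)) : dom j (w y) ->
    beta *m (tmat w y)^T =
    beta *m cmx (cotangent_cocycle B) (chart_at (w y)) j (w y) *m
      (tmat_in (chart_at y) j w y)^T.
  move=> jy; have sy : smooth_at w y := @eout_smooth _ _ c y.
  have := @tmat_in_comp _ _ _ _ (chart_at y) j (chart_at (w y)) w id y (chart_atP y)
    (smooth_at_in (chart_atP y) jy sy) (smooth_in_id jy (chart_atP (w y))).
  by rewrite /= /tmat -mulmxA -trmx_mul => <-.
exists (fun y : Z => csplit (y.1, v y)); last first.
  have bj : dom j (w z0) by exact: chart_atP.
  have nj : mnbhs (w z0) (dom j).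
    by apply: mnbhsS (mnbhs_chart bj (filterT : nbhs _ setT)) => b [].
  have sk : @smooth _ Z B (fun y => y.2.1).
    exact: (smooth_comp (smooth_snd _ _) (@bundle_proj_smooth _ _ (cotangent_cocycle B))).
  have nz := @smooth_at_mnbhs _ Z B _ (z0, (w z0, beta0)) _ (sk _) nj.
  apply: (@mnbhsS _ Z _ _ _ _ nz) => -[y [b beta]] jb h'.
  have e : w y = b := h'; have jb' : dom j b := jb.
  change (csplit (y, beta *m (tmat w y)^T + dE y) = csplit (y, v (y, (b, beta)))).
  clear h' jb; subst b.
  exact: (congr1 (fun u => csplit ((y, u + dE y) : cotangent (mprod A X))) (key y beta jb')).
apply: (@smooth_at_comp _ Z (cotangent (mprod A X))
  (mprod (cotangent A) (cotangent X)) (fun y => (y.1, v y))); last exact: csplit_smooth.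
apply: (@smooth_at_bundle _ (mprod A X) (cotangent_cocycle (mprod A X)) Z fst v).
  exact: smooth_fst.
have [U [oU Uz Ud Us]] := sw; have [V [oV Vz Vd Vs]] := sE.
pose n := dim (mprod A X); pose m := dim B.
pose pl (p : 'rV[R]_(n + (m + m))) : 'rV[R]_n := lsubmx p.
pose pr (p : 'rV[R]_(n + (m + m))) : 'rV[R]_(m + m) := rsubmx p.
pose z : Z := (z0, (w z0, beta0)).
pose UV := cod (chart_at z) `&` pl @^-1` (U `&` V).
have oUV : open UV.
  apply: openI; first exact: cod_open.
  by apply: open_lsub; exact: openI.
have zUV : UV (coord (chart_at z) z).
  split; first by apply: coord_cod; exact: chart_atP.
  by rewrite /preimage /= /pl row_mxKl.
exists UV; first by split; [exact: oUV|exact: zUV].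
split; first by move=> p [].
pose G p := rsubmx (pr p) *m
   (jacobian (fun q => coord j (w (icoord i q))) (pl p))^T +
   (jacobian (fun q => coord (m := rline) tt (E (icoord i q))) (pl p))^T.
have sG : smooth_on UV G.
  have spl : smooth_on UV pl by apply: smooth_on_lsub => //; exact: smooth_on_id.
  have spr : smooth_on UV pr by apply: smooth_on_rsub => //; exact: smooth_on_id.
  apply: smooth_onD => //.
    apply: smooth_on_mul => //; first exact: smooth_on_rsub.
    apply: smooth_on_tr => //.
    apply: (@smooth_on_comp _ _ _ _ _ _ U pl) => //; first by move=> p [_ []].
    exact: smooth_on_jacobian.
  apply: smooth_on_tr => //.
  apply: (@smooth_on_comp _ _ _ _ _ _ V pl) => //; first by move=> p [_ []].
  exact: (smooth_on_jacobian oV Vs).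
apply: smooth_on_ext oUV _ sG => p [[c1 c2] [Up Vp]].
pose y := icoord i (pl p); pose b := icoord j (lsubmx (pr p)).
have iy : dom i y by exact: (icoord_dom c1).
have jb : dom j b by exact: (icoord_dom (c2 : cod j (lsubmx (pr p)))).
have yp : coord i y = pl p by rewrite /y icoordK.
have swy : smooth_in i j w y by exists U; split=> //; rewrite yp.
have sEy : @smooth_in _ (mprod A X) rline i tt E y.
  by exists V; split=> //; rewrite yp.
have sid : smooth_in i (chart_at y) id y by apply: smooth_in_id => //; exact: chart_atP.
have e1 := @tmat_in_comp _ _ _ _ i (chart_at y) j id w y iy sid
  (smooth_at_in (chart_atP y) (smooth_in_dom iy swy) (smooth_in_at iy swy)).
have e2 := @tmat_in_comp _ _ _ rline i (chart_at y) tt id E y iy sid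
  (@energy_smooth _ _ c y).
have e3 := @cmxM _ _ (cotangent_cocycle B) j (chart_at b) j b jb (chart_atP b) jb.
have e4 : rsubmx (pr p) *m cmx (cotangent_cocycle B) j (chart_at b) b *m
    cmx (cotangent_cocycle B) (chart_at b) j b = rsubmx (pr p).
  by rewrite -mulmxA e3 cmx1 // mulmx1.
have -> : G p = rsubmx (pr p) *m (tmat_in i j w y)^T +
    (@tmat_in _ (mprod A X) rline i tt E y)^T.
  by rewrite /G /tmat_in yp.
change (rsubmx (pr p) *m (tmat_in i j w y)^T +
    (@tmat_in _ (mprod A X) rline i tt E y)^T =
  (rsubmx (pr p) *m cmx (cotangent_cocycle B) j (chart_at b) b *m
    cmx (cotangent_cocycle B) (chart_at b) j b *m
    (tmat_in (chart_at y) j w y)^T + dE y) *m (tmat_in i (chart_at y) id y)^T).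
rewrite e4 mulmxDl -mulmxA -!trmx_mul.
have -> : tmat_in i (chart_at y) id y *m tmat_in (chart_at y) j w y = tmat_in i j w y.
  exact: esym e1.
by congr (_ + _^T); exact: e2.
Qed.

Definition Tstar_lens :
    lens (tensor (cotangent_lens_object A) (cotangent_lens_object X))
      (cotangent_lens_object B) :=
  @Lens _ (tensor (cotangent_lens_object A) (cotangent_lens_object X))
    (cotangent_lens_object B) w Tstar_bwd (@eout_smooth _ _ c) Tstar_bwd_smooth
    Tstar_bwd_over.

Definition Tstar_cell :
    ode_cell (cotangent_lens_object A) (cotangent_lens_object B) :=
  @OdeCell (cotangent_lens_object A) (cotangent_lens_object B)
    (cotangent_lens_object X) X react_lens Tstar_lens.
End Tstar.

End Structure.

(* The operations of a symmetric monoidal category, with composition written in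
   diagrammatic order, whose hom-sets are the
   quotients of hom by hom_eq.  A strong symmetric monoidal functor is defined by
   equations between these operations only. *)
Record smc_data := SMCData {
  ob : Type;
  hom : ob -> ob -> Type;
  hom_eq : forall A B, hom A B -> hom A B -> Prop;
  hom_id : forall A, hom A A;
  hom_comp : forall A B C, hom A B -> hom B C -> hom A C;
  munit : ob;
  mtens : ob -> ob -> ob;
  hom_tens : forall A B C D, hom A B -> hom C D -> hom (mtens A C) (mtens B D);
  massoc : forall A B C, hom (mtens (mtens A B) C) (mtens A (mtens B C));
  mlunit : forall A, hom (mtens munit A) A;
  mrunit : forall A, hom (mtens A munit) A;
  mbraid : forall A B, hom (mtens A B) (mtens B A)
}.
Arguments hom {s} A B.
Arguments hom_eq {s A B} f g.
Arguments hom_id {s} A.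
Arguments hom_comp {s A B C} f g.
Arguments munit {s}.
Arguments mtens {s} A B.
Arguments hom_tens {s A B C D} f g.
Arguments massoc {s} A B C.
Arguments mlunit {s} A.
Arguments mrunit {s} A.
Arguments mbraid {s} A B.

Declare Scope smc_scope.
Delimit Scope smc_scope with smc.
Notation "f =~= g" := (hom_eq f g) (at level 70) : smc_scope.
Notation "f >>> g" := (hom_comp f g) (at level 60, right associativity) : smc_scope.
Notation "A \ox B" := (mtens A B) (at level 40, left associativity) : smc_scope.
Notation "f \oh g" := (hom_tens f g) (at level 40, left associativity) : smc_scope.

Definition is_iso (C : smc_data) (A B : ob C) (f : hom A B) : Prop :=
  exists g : hom B A, (f >>> g =~= hom_id A)%smc /\ (g >>> f =~= hom_id B)%smc.

Record is_symmetric_monoidal_functor (C D : smc_data)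
    (F : ob C -> ob D)
    (Fhom : forall A B, hom A B -> hom (F A) (F B))
    (mu : forall A B, hom (F A \ox F B)%smc (F (A \ox B)%smc))
    (eps : hom munit (F munit)) : Prop := IsSymmetricMonoidalFunctor {
  functor_eq : forall A B (f g : hom A B), (f =~= g -> Fhom _ _ f =~= Fhom _ _ g)%smc;
  functor_id : forall A, (Fhom _ _ (hom_id A) =~= hom_id (F A))%smc;
  functor_comp : forall A B B' (f : hom A B) (g : hom B B'),
    (Fhom _ _ (f >>> g) =~= Fhom _ _ f >>> Fhom _ _ g)%smc;
  mu_iso : forall A B, is_iso (mu A B);
  eps_iso : is_iso eps;
  mu_natural : forall A B A' B' (f : hom A B) (g : hom A' B'),
    ((Fhom _ _ f \oh Fhom _ _ g) >>> mu B B' =~= mu A A' >>> Fhom _ _ (f \oh g))%smc;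
  mu_assoc : forall A B A',
    ((mu A B \oh hom_id (F A')) >>> mu (A \ox B) A' >>> Fhom _ _ (massoc A B A') =~=
     massoc (F A) (F B) (F A') >>> (hom_id (F A) \oh mu B A') >>> mu A (B \ox A'))%smc;
  mu_lunit : forall A,
    ((eps \oh hom_id (F A)) >>> mu munit A >>> Fhom _ _ (mlunit A) =~= mlunit (F A))%smc;
  mu_runit : forall A,
    ((hom_id (F A) \oh eps) >>> mu A munit >>> Fhom _ _ (mrunit A) =~= mrunit (F A))%smc;
  mu_braid : forall A B,
    (mu A B >>> Fhom _ _ (mbraid A B) =~= mbraid (F A) (F B) >>> mu B A)%smc
}.

Definition OpenErg (R : realType) : smc_data := {|
  ob := manifold R;
  hom := @erg_cell R;
  hom_eq := @erg_eq R;
  hom_id := @erg_id R;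
  hom_comp := @erg_comp R;
  munit := R0;
  mtens := @mprod R;
  hom_tens := @erg_tensor R;
  massoc := fun A B C => erg_of_map (@smooth_passoc R A B C);
  mlunit := fun A => erg_of_map (smooth_snd R0 A);
  mrunit := fun A => erg_of_map (smooth_fst A R0);
  mbraid := fun A B => erg_of_map (@smooth_pswap R A B)
|}.

Definition OpenODE (R : realType) : smc_data := {|
  ob := lens_object R;
  hom := @ode_cell R;
  hom_eq := @ode_eq R;
  hom_id := @ode_id R;
  hom_comp := @ode_comp R;
  munit := lens_unit;
  mtens := @tensor R;
  hom_tens := fun P Q P' Q' => @ode_tensor R P Q P' Q';
  massoc := fun P Q S => ode_of_lens (lens_assoc P Q S);
  mlunit := fun P => ode_of_lens (lens_lunit P);
  mrunit := fun P => ode_of_lens (lens_runit P);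
  mbraid := fun P Q => ode_of_lens (lens_braid P Q)
|}.

(* The monoidal structure of T^*, induced by T^*(A * B) ~ T^*A * T^*B and
   T^*R^0 ~ R^0. *)
Definition Tstar_mu (R : realType) (A B : manifold R) :=
  ode_of_lens (lens_cotangent_prod A B).
Definition Tstar_eps (R : realType) := ode_of_lens (@lens_cotangent_unit R).

(* Main.v *)
From mathcomp Require Import all_boot all_order all_algebra.
From mathcomp Require Import boolp functions reals topology normedtype derive.
Require Import Defs.

(* Pullback of covectors turns composition, pairing and projections into linear
   identities between covectors, and d(E + E' o k) = dE + k^* dE'.  With these
   rules T^* of a composite or of a product of systems agrees with the composite
   or product of the images up to T^*(X * Y) ~ T^*X (x) T^*Y on the parameter; a
   diffeomorphism i of states acts on the parameter by T^*i.  In the identity and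
   coherence laws the parameter and the state are single points, so that only the
   backward maps on T^*A have to be compared. *)

Set Implicit Arguments.
Unset Strict Implicit.
Unset Printing Implicit Defensive.
Import GRing.Theory numFieldNormedType.Exports.
Local Open Scope ring_scope.

Local Arguments eout {R A B} e z.
Local Arguments energy {R A B} e z.
Local Notation cot := cotangent_lens_object.

(** * Calculus of covectors: pullback, pairing and differentials *)

Section Covectors.
Context {R : realType}.
Implicit Types X Y Z : manifold R.

(** The fibre component of [copull], without the base point, so that pullbacks can be added and
    nested. *)
Definition cpull X Y (f : X -> Y) (x : X) (xi : 'rV[R]_(dim Y)) : 'rV[R]_(dim X) :=
  xi *m (tmat f x)^T.

Lemma cpullD X Y (f : X -> Y) x xi eta :
  cpull f x (xi + eta) = cpull f x xi + cpull f x eta.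
Proof. exact: mulmxDl. Qed.

Lemma cpull_id X (x : X) xi : cpull id x xi = xi.
Proof. by rewrite /cpull tmat_id trmx1 mulmx1. Qed.

Lemma cpull_comp X Y Z (f : X -> Y) (g : Y -> Z) x xi : smooth f -> smooth g ->
  cpull (g \o f) x xi = cpull f x (cpull g (f x) xi).
Proof.
move=> sf sg; rewrite /cpull tmat_comp; [|exact: sf|exact: sg].
by rewrite trmx_mul mulmxA.
Qed.

(** A typed [row_mx]: [dim (mprod X Y)] is [dim X + dim Y] only by conversion, and the rules for
    [cpull] need the manifolds in the type. *)
Definition cpair X Y (xi : 'rV[R]_(dim X)) (eta : 'rV[R]_(dim Y)) :
  'rV[R]_(dim (mprod X Y)) := row_mx xi eta.

Lemma cpairP X Y (xi : 'rV[R]_(dim (mprod X Y))) :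
  exists u v, xi = @cpair X Y u v.
Proof. by exists (lsubmx xi), (rsubmx xi); rewrite /cpair hsubmxK. Qed.

Lemma cpairD X Y u v u' v' :
  @cpair X Y u v + @cpair X Y u' v' = cpair (u + u') (v + v').
Proof. by rewrite /cpair add_row_mx. Qed.

Lemma csplitE X Y x u v :
  @csplit R X Y (x, cpair u v) = ((x.1, u), (x.2, v)).
Proof. by rewrite /csplit /bsplit /= row_mxKl row_mxKr. Qed.

(** The Jacobian of a pairing is a row of two blocks; its transpose is a column, and multiplying a
    row by a column of blocks adds the two pullbacks. *)
Lemma cpull_pair X Y Z (f : X -> Y) (g : X -> Z) x xi eta : smooth f -> smooth g ->
  @cpull X (mprod Y Z) (fun z => (f z, g z)) x (cpair xi eta) =
  cpull f x xi + cpull g x eta.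
Proof.
move=> sf sg; rewrite /cpull tmat_pair; [|exact: sf|exact: sg].
by rewrite tr_row_mx mul_row_col.
Qed.

Lemma cpull_fst X Y (z : mprod X Y) xi :
  @cpull (mprod X Y) X fst z xi = cpair xi 0.
Proof. by rewrite /cpull tmat_fst tr_col_mx trmx1 trmx0 mul_mx_row mulmx1 mulmx0. Qed.

Lemma cpull_snd X Y (z : mprod X Y) xi :
  @cpull (mprod X Y) Y snd z xi = cpair 0 xi.
Proof. by rewrite /cpull tmat_snd tr_col_mx trmx1 trmx0 mul_mx_row mulmx1 mulmx0. Qed.

Definition differential X (f : X -> R) (x : X) : 'rV[R]_(dim X) :=
  (@tmat _ X rline f x)^T.

Lemma differential_comp X Y (f : X -> Y) (g : Y -> R) x :
  smooth f -> @smooth _ Y rline g ->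
  differential (g \o f) x = cpull f x (differential g (f x)).
Proof.
move=> sf sg; rewrite /differential /cpull -trmx_mul; congr _^T.
exact: (@tmat_comp _ X Y rline f g x (sf x) (sg (f x))).
Qed.

Lemma differential_cst X (c : R) x : differential (fun _ : X => c) x = 0.
Proof.
have df := smooth_in_diff (@smooth_cst _ X rline c x).
(* Transposing back leaves a Jacobian, whose rows are directional derivatives of a constant. *)
apply/eqP; rewrite -(inj_eq trmx_inj) trmxK trmx0; apply/eqP/row_matrixP => i.
rewrite row0; apply: (etrans (row_jacobian i df)).
exact: derive_cst.
Qed.

(** The chart of [rline] sends a real number to a scalar 1 x 1 matrix, which is additive, so the sum
    rule for directional derivatives applies to each row of the Jacobian. *)
Lemma differentialD X (f g : X -> R) x :
  @smooth _ X rline f -> @smooth _ X rline g ->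
  differential (fun y => f y + g y) x = differential f x + differential g x.
Proof.
move=> sf sg.
rewrite /differential -raddfD /=; congr _^T.
pose p := coord (chart_at x) x.
pose F q : 'rV[R]_1 := (f (icoord (chart_at x) q))%:M.
pose G q : 'rV[R]_1 := (g (icoord (chart_at x) q))%:M.
have df : differentiable F p := smooth_in_diff (sf x).
have dg : differentiable G p := smooth_in_diff (sg x).
have FG : (fun q => (f (icoord (chart_at x) q) + g (icoord (chart_at x) q))%:M) = F + G.
  by apply/funext => q; rewrite /= fctE /F /G /= raddfD.
change (jacobian (fun q => (f (icoord (chart_at x) q) + g (icoord (chart_at x) q))%:M) p
  = jacobian F p + jacobian G p).
rewrite FG; have dFG : differentiable (F + G) p by exact: differentiableD.
apply/row_matrixP => i; apply: (etrans (row_jacobian i dFG)).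
apply: (etrans (deriveD (diff_derivable df) (diff_derivable dg))).
rewrite -(row_jacobian i df) -(row_jacobian i dg).
have rowD (A B : 'M[R]_(dim X, 1)) : row i (A + B) = row i A + row i B.
  by apply/rowP => j; rewrite !mxE.
exact: esym (rowD _ _).
Qed.

End Covectors.

(** * One-point manifolds and lenses between them *)

Section Points.
Context {R : realType}.
Implicit Types (X Y : manifold R) (P Q : lens_object R).

(** Covers the products and cotangent bundles built from [R0], which are points without being [R0]
    itself. Recording the dimension makes the fibres of their tangent and cotangent bundles
    trivial. *)
Definition is_point X : Prop := dim X = 0%N /\ exists x : X, all_equal_to x.

Lemma point_all_eq X (x y : X) : is_point X -> x = y.
Proof. by move=> [_ [z zE]]; rewrite (zE x) (zE y). Qed.

Lemma is_point_R0 : is_point (@R0 R).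
Proof. by split=> //; exists (0 : R0) => x; exact: R0E. Qed.

Lemma is_point_prod X Y : is_point X -> is_point Y -> is_point (mprod X Y).
Proof.
move=> [dX [x xE]] [dY [y yE]]; split; first by rewrite /= dX dY.
by exists (x, y) => -[u v]; rewrite (xE u) (yE v).
Qed.

Lemma is_point_bundle X (g : cocycle X) :
  is_point X -> rank g = 0%N -> is_point (bundle g).
Proof.
move=> [dX [x xE]] rg; split; first by rewrite /= dX rg.
exists (x, 0) => -[u v]; rewrite (xE u); congr pair.
by apply/rowP => i; case: (cast_ord rg i).
Qed.

Definition lens_point P : Prop := is_point (total P) /\ is_point (base P).

Lemma lens_point_unit : lens_point (@lens_unit R).
Proof. by split; exact: is_point_R0. Qed.

Lemma lens_point_tensor P Q : lens_point P -> lens_point Q -> lens_point (tensor P Q).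
Proof. by move=> [? ?] [? ?]; split; exact: is_point_prod. Qed.

Lemma lens_point_cotangent X : is_point X -> lens_point (cotangent_lens_object X).
Proof. by move=> pX; split=> //; apply: is_point_bundle => //; case: pX. Qed.

(** Constant maps do. The conclusion is [inhabited] because the elements come from existential
    propositions and cannot be extracted as data. *)
Lemma point_diffeo X Y : is_point X -> is_point Y -> inhabited (diffeo X Y).
Proof.
move=> pX pY; have [_ [x _]] := pX; have [_ [y _]] := pY.
by split; apply: (@Diffeo _ X Y (fun=> y) (fun=> x)); try exact: smooth_cst;
  move=> z; exact: point_all_eq.
Qed.

Lemma point_lens P Q : lens_point P -> lens_point Q -> inhabited (lens P Q).
Proof.
move=> [[_ [t _]] pb] [_ [_ [b _]]]; split.
apply: (@lens_of_maps _ P Q (fun=> b) (fun=> t)); try exact: smooth_cst.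
by move=> x z _; exact: point_all_eq.
Qed.

Lemma lens_eq_point P Q (l m : lens P Q) :
  is_point (total P) -> is_point (base Q) -> lens_eq l m.
Proof. by move=> pP pQ; split=> *; exact: point_all_eq. Qed.

End Points.

(** * Backward maps as relations, and equality of 1-cells over points *)

Section Backward.
Context {R : realType}.
Implicit Types P Q S : lens_object R.

(* A relational form of bwd: the proof components of pullbacks, which grow
   quickly with composition, never appear in goals. *)
Definition back P Q (l : lens P Q) (x : base P) (y : total Q) (t : total P) : Prop :=
  exists h, bwd l (exist _ (x, y) h) = t.

Lemma back_bwd P Q (l : lens P Q) x y t h :
  back l x y t -> bwd l (exist _ (x, y) h) = t.
Proof. by case=> k <-; exact: bwd_ext. Qed.

(** Reduces equality of lenses to naming a common backward value, which the rules below then check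
    piece by piece on each side. *)
Lemma lens_eqP P Q (l m : lens P Q) : (forall x, fwd l x = fwd m x) ->
  (forall x y, fwd l x = lproj Q y -> exists2 t, back l x y t & back m x y t) ->
  lens_eq l m.
Proof.
move=> fE bE; split=> // -[x y] h k.
by have [t lt mt] := bE x y h; rewrite (back_bwd h lt) (back_bwd k mt).
Qed.

Lemma back_comp P Q S (l : lens P Q) (m : lens Q S) x y s t :
  back m (fwd l x) y s -> back l x s t -> back (lens_comp l m) x y t.
Proof.
by case=> h <- [k <-]; exists h; rewrite /= /lens_comp_bwd /=; exact: bwd_ext.
Qed.

Lemma back_tensor P Q P' Q' (l : lens P Q) (m : lens P' Q') x x' y y' t t' :
  back l x y t -> back m x' y' t' ->
  back (tensor_lens l m) (x, x') (y, y') (t, t').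
Proof.
case=> h <- [k <-].
have e : fwd (tensor_lens l m) (x, x') = lproj (tensor Q Q') (y, y').
  by congr pair.
by exists e; congr pair; exact: bwd_ext.
Qed.

Lemma back_maps P Q (f : base P -> base Q) (b : total Q -> total P) fs bs over x z :
  f x = lproj Q z -> back (@lens_of_maps _ P Q f b fs bs over) x z (b z).
Proof. by move=> h; exists h. Qed.

Lemma back_id P x z : x = lproj P z -> back (lens_id P) x z z.
Proof. by move=> h; exact: back_maps. Qed.

(** Provides the base-point conditions that [back_maps] and [back_id] ask for. *)
Lemma back_over P Q (l : lens P Q) x y t : back l x y t -> x = lproj P t.
Proof. by case=> h <-; rewrite bwd_over. Qed.

(** The second system runs backward first; its component [s] over the middle object is the input of
    the first system. *)
Lemma back_ode_comp P Q S (c : ode_cell P Q) (d : ode_cell Q S) x p q y s s' t t' :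
  back (olens d) (fwd (olens c) (x, p), q) y (s, s') ->
  back (olens c) (x, p) s (t, t') ->
  back (olens (ode_comp c d)) (x, (p, q)) y (t, (t', s')).
Proof.
move=> bd bc; have [_ eq] := back_over bd.
(* The value before the inverse associator regroups it. *)
apply: (@back_comp _ _ _ (lens_assoc_inv P (oparam c) (oparam d)) _ _ _
  (((t, t'), s') : total (tensor (tensor P (oparam c)) (oparam d)))).
  apply: back_comp; first exact: bd.
  by apply: back_tensor => //; exact: back_id.
apply: back_maps.
by rewrite /= /prod_map /= -eq; have [-> ->] := back_over bc.
Qed.

(** The right unitor inserts 0 in [R0]; every [o] equals it, so [o] can stay free. *)
Lemma back_ode_of_lens P Q (l : lens P Q) x p y t o :
  back l x y t -> back (olens (ode_of_lens l)) (x, p) y (t, o).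
Proof.
move=> b; apply: back_comp; first exact: b.
by rewrite (R0E o 0); apply: back_maps; exact: back_over b.
Qed.

Lemma back_ode_id P x p y o :
  x = lproj P y -> back (olens (ode_id P)) (x, p) y (y, o).
Proof. by move=> e; rewrite (R0E o 0); exact: back_maps. Qed.

Lemma back_ode_tensor P Q P' Q' (c : ode_cell P Q) (d : ode_cell P' Q')
    x x' p q y y' t t' s s' :
  back (olens c) (x, p) y (t, s) -> back (olens d) (x', q) y' (t', s') ->
  back (olens (ode_tensor c d)) ((x, x'), (p, q)) (y, y') ((t, t'), (s, s')).
Proof.
move=> bc bd; apply: back_comp; first by apply: back_tensor; [exact: bc|exact: bd].
apply: back_maps.
by have [-> ->] := back_over bc; have [-> ->] := back_over bd.
Qed.

(** Between points the required isomorphisms exist and the condition on open ODEs holds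
    automatically; only the main lenses are left to compare. The parameters [p], [q] and the values
    [s], [s'] may be chosen independently, each being the only element of its manifold. *)
Lemma ode_eq_point P Q (c d : ode_cell P Q) :
  lens_point (oparam c) -> is_point (ostate c) ->
  lens_point (oparam d) -> is_point (ostate d) ->
  (forall x p q, fwd (olens c) (x, p) = fwd (olens d) (x, q)) ->
  (forall x p q y, fwd (olens c) (x, p) = lproj Q y ->
     exists t s s', back (olens c) (x, p) y (t, s) /\ back (olens d) (x, q) y (t, s')) ->
  ode_eq c d.
Proof.
move=> pc sc pd sd ef eb.
have [phi] := point_diffeo sc sd.
have [g] := point_lens pc pd; have [g'] := point_lens pd pc.
(* The backward maps in the condition on open ODEs take values in this tangent bundle. *)
have tc : is_point (tangent (ostate c)) by apply: is_point_bundle => //; case: sc.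
exists phi, g, g'; split.
- by case: pc pd => ? ? [? ?]; split; exact: lens_eq_point.
- by apply: lens_eq_point => //; case: pd.
- apply: lens_eqP; first by case=> x p; exact: ef.
  case=> x p y h; have [t [s [s' [bc bd]]]] := eb x p (fwd g p) y h.
  exists (t, s) => //; apply: back_comp; first exact: bd.
  apply: back_tensor.
    by apply: back_id; have [] := back_over bc.
  have gs : fwd g p = lproj (oparam d) s' by exact: point_all_eq pd.2.
  by exists gs; exact: point_all_eq pc.1.
Qed.

(** A composite of two lenses seen as 1-cells has a point as parameter and as state, so
    [ode_eq_point] reduces the inverse laws to those of the lenses. *)
Lemma is_iso_ode_of_lens P Q (l : lens P Q) (m : lens Q P) : lens_inverse l m ->
  @is_iso (OpenODE R) P Q (ode_of_lens l).
Proof.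
suff H P' Q' (l' : lens P' Q') (m' : lens Q' P') :
    lens_eq (lens_comp l' m') (lens_id P') ->
    ode_eq (ode_comp (ode_of_lens l') (ode_of_lens m')) (ode_id P').
  by case=> lm ml; exists (ode_of_lens m); split; exact: H.
case=> f b; apply: ode_eq_point.
- exact: (lens_point_tensor lens_point_unit lens_point_unit).
- exact: (is_point_prod is_point_R0 is_point_R0).
- exact: lens_point_unit.
- exact: is_point_R0.
- by move=> x p q; exact: (f x).
move=> x [p p'] q y h; have e : x = lproj P' y by rewrite -[LHS](f x).
exists y, (0, 0), 0; split; last exact: back_ode_id.
apply: back_ode_comp; first by apply: back_ode_of_lens; exists h.
(* The intermediate value is [bwd m'] at [y], and [bwd_over] shows that it lies over [fwd l' x]. *)
apply: back_ode_of_lens; exists (esym (bwd_over m' (exist _ (fwd l' x, y) h))).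
by rewrite -[RHS](b (x, y) h e) /= /lens_comp_bwd /=; exact: bwd_ext.
Qed.

End Backward.

(** * Cotangent bundles of products and of the unit, and the backward map of [Tstar_lens] *)

Section Cotangents.
Context {R : realType}.
Implicit Types X Y A B C : manifold R.

Lemma csplitK X Y : cancel (@csplit R X Y) (@cmerge R X Y).
Proof. by case=> -[x y] v; rewrite /cmerge /bmerge /= hsubmxK. Qed.

Lemma cmergeK X Y : cancel (@cmerge R X Y) (@csplit R X Y).
Proof. by case=> -[x u] [y v]; rewrite /csplit /bsplit /= row_mxKl row_mxKr. Qed.

Fact cotangent_merge_over X Y (x : base (cot (mprod X Y)))
    (z : total (tensor (cot X) (cot Y))) :
  x = lproj (tensor (cot X) (cot Y)) z ->
  lproj (cot (mprod X Y)) (cmerge z) = x.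
Proof. by move=> ->. Qed.

Definition lens_cotangent_merge X Y : lens (cot (mprod X Y))
    (tensor (cot X) (cot Y)) :=
  @lens_of_maps _ (cot (mprod X Y))
    (tensor (cot X) (cot Y)) id (@cmerge _ X Y)
    (smooth_id (X := mprod X Y)) (@cmerge_smooth _ X Y) (@cotangent_merge_over X Y).

Lemma lens_cotangent_prod_inverse X Y :
  lens_inverse (lens_cotangent_prod X Y) (lens_cotangent_merge X Y).
Proof.
split; split=> // -[x y] h k.
  exact: cmergeK.
exact: csplitK.
Qed.

Fact cotangent_unit_inv_over (x : base (cot (@R0 R)))
    (z : total (@lens_unit R)) :
  x = lproj lens_unit z ->
  lproj (cot (@R0 R)) ((z, 0) : cotangent R0) = x.
Proof. by move=> ->. Qed.

Definition lens_cotangent_unit_inv :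
    lens (cot (@R0 R)) lens_unit :=
  @lens_of_maps _ (cot R0) lens_unit id
    (fun z => (z, 0) : cotangent R0)
    (smooth_id (X := R0)) (smooth_zero_section _ (smooth_id (X := R0)))
    cotangent_unit_inv_over.

(** [R0] and its cotangent bundle are both points, so any two parallel lenses between them agree. *)
Lemma lens_cotangent_unit_inverse :
  lens_inverse (@lens_cotangent_unit R) lens_cotangent_unit_inv.
Proof.
have := lens_point_cotangent (@is_point_R0 R) => -[pt _].
have p0 := @is_point_R0 R.
by split; exact: lens_eq_point.
Qed.

(** The hypothesis computes the covector on the product before it is split, so all later work is an
    identity between covectors. *)
Lemma back_Tstar_lens A B (c : erg_cell A B) x p xi u v :
  cpull (eout c) (x, p) xi + differential (energy c) (x, p) =
    @cpair R A (estate c) u v ->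
  back (Tstar_lens c) (x, p) (eout c (x, p), xi) ((x, u), (p, v)).
Proof.
move=> e; exists erefl.
apply: etrans (csplitE (x, p) u v).
exact: (congr1 (fun w => @csplit R A (estate c) ((x, p), w)) e).
Qed.

(** The energy is constant, so its differential vanishes, and the output factors through the
    projection to [A], so the state component is zero. *)
Lemma back_Tstar_lens_of_map A B (f : A -> B) (sf : smooth f) x p xi s :
  back (Tstar_lens (erg_of_map sf)) (x, p) (f x, xi) ((x, cpull f x xi), s).
Proof.
have -> : s = ((p : @R0 R), 0).
  exact: point_all_eq (lens_point_cotangent (@is_point_R0 R)).1.
apply: (@back_Tstar_lens A B (erg_of_map sf)).
rewrite [differential _ _]differential_cst addr0 -(cpull_fst ((x, p) : mprod A R0)).
exact: (cpull_comp ((x, p) : mprod A R0) xi (smooth_fst A R0) sf).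
Qed.

Lemma back_cotangent_prod X Y (x : X) (y : Y) xi eta :
  back (lens_cotangent_prod X Y) (x, y) ((x, y), cpair xi eta) ((x, xi), (y, eta)).
Proof. by exists erefl; exact: csplitE. Qed.

Lemma back_cotangent_merge X Y (x : X) (y : Y) xi eta :
  back (lens_cotangent_merge X Y) (x, y) ((x, xi), (y, eta)) ((x, y), cpair xi eta).
Proof. by exists erefl. Qed.

(** Each component of [passoc] is a projection, so the pullback is a sum of covectors supported on
    one factor each. *)
Lemma cpull_passoc A B C (z : mprod (mprod A B) C) u v w :
  @cpull R (mprod (mprod A B) C) (mprod A (mprod B C)) (@passoc A B C) z
    (cpair u (cpair v w)) = cpair (cpair u v) w.
Proof.
pose b : mprod (mprod A B) C -> B := fun z => z.1.2.
have sb : smooth b := smooth_comp (smooth_fst (mprod A B) C) (smooth_snd A B).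
have sa := smooth_comp (smooth_fst (mprod A B) C) (smooth_fst A B).
(* [passoc] is a pairing only after unfolding, hence the ascribed type in place of a direct
   rewrite. *)
have e1 : @cpull R (mprod (mprod A B) C) (mprod A (mprod B C)) (@passoc A B C) z
    (cpair u (cpair v w)) = _ :=
  cpull_pair z u (cpair v w) sa (smooth_pair sb (smooth_snd (mprod A B) C)).
rewrite {}e1.
rewrite (cpull_pair z v w sb (smooth_snd (mprod A B) C)).
rewrite !cpull_comp ?cpull_fst ?cpull_snd;
  [|exact: smooth_fst|exact: smooth_snd|exact: smooth_fst|exact: smooth_fst].
by rewrite !(cpairD, addr0, add0r).
Qed.

Lemma cpull_pswap A B (z : mprod A B) u v :
  @cpull R (mprod A B) (mprod B A) (@pswap A B) z (cpair u v) = cpair v u.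
Proof.
rewrite cpull_pair; [|exact: smooth_snd|exact: smooth_fst].
by rewrite cpull_fst cpull_snd !(cpairD, addr0, add0r).
Qed.

End Cotangents.

Ltac points := repeat first
  [ exact: is_point_R0 | exact: lens_point_unit
  | exact: (lens_point_cotangent (@is_point_R0 _))
  | refine (lens_point_tensor _ _) | refine (is_point_prod _ _) ].

(** * Identity and coherence laws *)

Section Coherence.
Context {R : realType}.
Implicit Types A B C : manifold R.

Lemma Tstar_id A :
  ode_eq (Tstar_cell (erg_id A)) (ode_id (cot A)).
Proof.
apply: ode_eq_point; [by points|by points|by points|by points|by []|].
(* The equation [h] identifies the base point of the covector with the forward image; only its fibre
   coordinates [xi] stay free. *)
move=> a p q [b0 xi] h; rewrite -[b0]h {b0 h}.
exists (a, xi), (p, 0), 0; split; last exact: back_ode_id.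
by rewrite -[in X in back _ _ _ X](cpull_id a xi); exact: back_Tstar_lens_of_map.
Qed.

(** Both sides split a covector on the product and exchange its two components. *)
Lemma Tstar_braid A B :
  ode_eq (ode_comp (Tstar_mu A B) (Tstar_cell (erg_of_map (@smooth_pswap R A B))))
    (ode_comp (ode_of_lens (lens_braid (cot A) (cot B))) (Tstar_mu B A)).
Proof.
apply: ode_eq_point; [by points|by points|by points|by points|by []|].
move=> [a b] [p p'] [q q'] [b0 xi] h; rewrite -[b0]h {b0 h}.
have [v [u ->]] := cpairP xi.
(* The last two entries are parameters: 0 in [R0] for each structural lens, and [(p', 0)] in T^*R^0
   for the image of the swap. *)
exists ((a, u), (b, v)), (0, (p', 0)), (0, 0); split.
  apply: back_ode_comp; first exact: back_Tstar_lens_of_map.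
  by rewrite cpull_pswap; apply: back_ode_of_lens; exact: back_cotangent_prod.
apply: back_ode_comp; first by apply: back_ode_of_lens; exact: back_cotangent_prod.
by apply: back_ode_of_lens; exact: back_maps.
Qed.

(** A covector on the triple product has components [u], [v], [w], which both sides only regroup. *)
Lemma Tstar_assoc A B C :
  ode_eq
    (ode_comp (ode_tensor (Tstar_mu A B) (ode_id (cot C)))
      (ode_comp (Tstar_mu (mprod A B) C)
        (Tstar_cell (erg_of_map (@smooth_passoc R A B C)))))
    (ode_comp (ode_of_lens (lens_assoc (cot A) (cot B) (cot C)))
      (ode_comp (ode_tensor (ode_id (cot A)) (Tstar_mu B C)) (Tstar_mu A (mprod B C)))).
Proof.
apply: ode_eq_point; [by points|by points|by points|by points|by []|].
move=> [[a b] c] [[p1 p2] [p3 p4]] [q1 [[q2 q3] q4]] [b0 xi] h; rewrite -[b0]h {b0 h}.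
have [u [vw ->]] := cpairP xi; have [v [w ->]] := cpairP vw.
exists (((a, u), (b, v)), (c, w)), ((0, 0), (0, (p4, 0))), (0, ((0, 0), 0)); split.
  apply: back_ode_comp.
    apply: back_ode_comp; first exact: back_Tstar_lens_of_map.
    by rewrite cpull_passoc; apply: back_ode_of_lens; exact: back_cotangent_prod.
  apply: back_ode_tensor; last exact: back_ode_id.
  by apply: back_ode_of_lens; exact: back_cotangent_prod.
apply: back_ode_comp.
  apply: back_ode_comp; first by apply: back_ode_of_lens; exact: back_cotangent_prod.
  apply: back_ode_tensor; first exact: back_ode_id.
  by apply: back_ode_of_lens; exact: back_cotangent_prod.
by apply: back_ode_of_lens; exact: back_maps.
Qed.

(** Pulling back along the projection puts 0 in the fibre over [R0], and [Tstar_eps] then forgets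
    that fibre. *)
Lemma Tstar_lunit A :
  ode_eq (ode_comp (ode_tensor (Tstar_eps R) (ode_id (cot A)))
      (ode_comp (Tstar_mu R0 A) (Tstar_cell (erg_of_map (smooth_snd R0 A)))))
    (ode_of_lens (lens_lunit (cot A))).
Proof.
apply: ode_eq_point; [by points|by points|by points|by points|by []|].
move=> [o a] [[p1 p2] [p3 p4]] q [b0 xi] h; rewrite -[b0]h {b0 h}.
exists (o, (a, xi)), ((0, 0), (0, (p4, 0))), 0; split.
  apply: back_ode_comp.
    apply: back_ode_comp; first exact: back_Tstar_lens_of_map.
    by rewrite cpull_snd; apply: back_ode_of_lens; exact: back_cotangent_prod.
  apply: back_ode_tensor; last exact: back_ode_id.
  by apply: back_ode_of_lens; exact: back_maps.
by apply: back_ode_of_lens; rewrite (R0E o 0); exact: back_maps.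
Qed.

Lemma Tstar_runit A :
  ode_eq (ode_comp (ode_tensor (ode_id (cot A)) (Tstar_eps R))
      (ode_comp (Tstar_mu A R0) (Tstar_cell (erg_of_map (smooth_fst A R0)))))
    (ode_of_lens (lens_runit (cot A))).
Proof.
apply: ode_eq_point; [by points|by points|by points|by points|by []|].
move=> [a o] [[p1 p2] [p3 p4]] q [b0 xi] h; rewrite -[b0]h {b0 h}.
exists ((a, xi), o), ((0, 0), (0, (p4, 0))), 0; split.
  apply: back_ode_comp.
    apply: back_ode_comp; first exact: back_Tstar_lens_of_map.
    by rewrite cpull_fst; apply: back_ode_of_lens; exact: back_cotangent_prod.
  apply: back_ode_tensor; first exact: back_ode_id.
  by apply: back_ode_of_lens; exact: back_maps.
by apply: back_ode_of_lens; rewrite (R0E o 0); exact: back_maps.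
Qed.

End Coherence.

(** * Cotangent lenses of maps, and independence of the representative *)

Section CotangentLens.
Context {R : realType}.
Implicit Types (X Y Z A B C : manifold R) (P Q : lens_object R).

Fact runit_inv_over P (x : base P) (z : total (tensor P lens_unit)) :
  (x, 0 : R0) = lproj (tensor P lens_unit) z -> lproj P z.1 = x.
Proof. by case: z => ? ? [-> _]. Qed.

Definition lens_runit_inv P : lens P (tensor P lens_unit) :=
  @lens_of_maps _ P (tensor P lens_unit) _ _
    (@smooth_runit_inv _ (base P)) (smooth_fst (total P) R0) (@runit_inv_over P).

(* T^*f as a lens; its backward map is smooth because that of Tstar_lens is. *)
Definition lens_cotangent X Y (f : X -> Y) (sf : smooth f) : lens (cot X) (cot Y) :=
  lens_comp (lens_runit_inv (cot X))
    (lens_comp (tensor_lens (lens_id (cot X)) (@lens_cotangent_unit R))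
      (Tstar_lens (erg_of_map sf))).

Lemma back_lens_cotangent X Y (f : X -> Y) (sf : smooth f) x xi :
  back (lens_cotangent sf) x (f x, xi) (x, cpull f x xi).
Proof.
apply: back_comp.
  apply: back_comp.
    exact: (@back_Tstar_lens_of_map _ _ _ _ sf x _ xi ((0 : R0), 0)).
  by apply: back_tensor; [exact: back_id|exact: back_maps].
exact: back_maps.
Qed.

(** Pullback is contravariantly functorial, so each composite pulls back along an identity; the two
    laws differ by exchanging [f] and [g]. *)
Lemma lens_cotangent_inverse X Y (f : X -> Y) (g : Y -> X) (sf : smooth f)
    (sg : smooth g) : cancel f g -> cancel g f ->
  lens_inverse (lens_cotangent sf) (lens_cotangent sg).
Proof.
suff H X' Y' (f' : X' -> Y') (g' : Y' -> X') (sf' : smooth f') (sg' : smooth g') :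
    cancel f' g' ->
    lens_eq (lens_comp (lens_cotangent sf') (lens_cotangent sg')) (lens_id (cot X')).
  by move=> fg gf; split; exact: H.
move=> fg; apply: lens_eqP; first exact: fg.
move=> x [x' xi] h; rewrite -[x']h {x' h}.
exists (x, cpull f' x (cpull g' (f' x) xi)).
  by apply: back_comp; exact: back_lens_cotangent.
rewrite -cpull_comp // (_ : g' \o f' = id) ?cpull_id; last exact/funext.
by rewrite /= fg; exact: back_id.
Qed.

Lemma tmapK X Y (f : X -> Y) (g : Y -> X) : smooth f -> smooth g -> cancel f g ->
  cancel (tmap f) (tmap g).
Proof.
move=> sf sg fg [x v]; rewrite /tmap /= fg; congr pair.
rewrite -mulmxA -tmat_comp; [|exact: sf|exact: sg].
have -> : g \o f = id by apply/funext.
by rewrite tmat_id mulmx1.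
Qed.

Lemma back_react_lens A B (c : erg_cell A B) x xi :
  back (react_lens c) x (x, xi) (ereact c (x, xi)).
Proof. exact: back_maps. Qed.

(** The diffeomorphism [i] acts on states and T^*i on parameters. The condition on open ODEs is the
    transport of reactions; the condition on lenses is the chain rule for id x i. *)
Lemma Tstar_eq A B (c d : erg_cell A B) : erg_eq c d ->
  ode_eq (Tstar_cell c) (Tstar_cell d).
Proof.
move=> [i [tr ew eE]].
have si := @dfun_smooth _ _ _ i; have sj := @dinv_smooth _ _ _ i.
exists i, (lens_cotangent si), (lens_cotangent sj); split.
- by apply: lens_cotangent_inverse; [exact: dfunK|exact: dinvK].
- apply: lens_eqP => // x [y xi] h; rewrite -[y]h {y h}.
  exists (ereact c (x, cpull i x xi)).
    by apply: back_comp; [exact: back_lens_cotangent|exact: back_react_lens].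
  (* Transport writes the reaction of [d] through Ti, which the backward map of [tangent_lens i]
     cancels. *)
  rewrite -(tmapK si sj (@dfunK _ _ _ i) (ereact c _)) -(tr x xi).
  apply: back_comp; first exact: back_react_lens.
  by apply: back_maps; rewrite /= react_over.
- apply: lens_eqP; first by case=> a x; exact: ew.
  move=> [a x] [b xi] h; rewrite -[b]h {b h}.
  (* Output and energy of [c] are those of [d] precomposed with this map. *)
  pose f (z : mprod A (estate c)) : mprod A (estate d) := (z.1, i z.2).
  have s1 := smooth_fst A (estate c).
  have s2 := smooth_comp (smooth_snd A (estate c)) si.
  have sf : smooth f := smooth_pair s1 s2.
  have ew' : eout c = eout d \o f by apply/funext => -[]; exact: ew.
  have eE' : energy c = energy d \o f by apply/funext => -[]; exact: eE.
  have [u [v e]] :=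
    cpairP (cpull (eout d) (a, i x) xi + differential (energy d) (a, i x)).
  exists ((a, u), (x, cpull i x v)).
    apply: back_Tstar_lens; rewrite ew' eE'.
    rewrite (cpull_comp _ _ sf (@eout_smooth _ _ _ d)).
    rewrite (differential_comp _ sf (@energy_smooth _ _ _ d)) -cpullD e.
    rewrite (cpull_pair _ _ _ s1 s2) cpull_fst cpull_comp //; last exact: smooth_snd.
    by rewrite cpull_snd !(cpairD, addr0, add0r).
  apply: back_comp; first by rewrite /= ew; exact: back_Tstar_lens e.
  by apply: back_tensor; [exact: back_id|exact: back_lens_cotangent].
Qed.

End CotangentLens.

(** * Composition and naturality of the monoidal comparison *)

Section Functoriality.
Context {R : realType}.
Implicit Types (X Y Z A B C D : manifold R) (P Q : lens_object R).

Lemma sum_reactionE X Y (S : reaction X) (T : reaction Y) x y u v :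
  sum_reaction S T ((x, y), cpair u v) = tmerge (S (x, u), T (y, v)).
Proof.
exact: (congr1 (fun z => tmerge (prod_map S T z)) (csplitE (x, y) u v)).
Qed.

Lemma lens_inverse_sym P Q (l : lens P Q) (m : lens Q P) :
  lens_inverse l m -> lens_inverse m l.
Proof. by case. Qed.

Definition diffeo_id X : diffeo X X :=
  Diffeo (smooth_id (X := X)) (smooth_id (X := X)) (fun=> erefl) (fun=> erefl).

Definition diffeo_pswap X Y : diffeo (mprod X Y) (mprod Y X) :=
  @Diffeo _ (mprod X Y) (mprod Y X) (@pswap X Y) (@pswap Y X)
    (@smooth_pswap R X Y) (@smooth_pswap R Y X)
    (fun z => esym (surjective_pairing z)) (fun z => esym (surjective_pairing z)).

Lemma tmap_id X (z : tangent X) : tmap id z = z.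
Proof. by case: z => x v; rewrite /tmap /= tmat_id mulmx1. Qed.

Lemma tmap_pswap X Y (s : tangent X) (t : tangent Y) :
  @tmap R (mprod X Y) (mprod Y X) (@pswap X Y) (tmerge (s, t)) = tmerge (t, s).
Proof.
case: s t => [x u] [y v]; congr pair.
rewrite [tmat _ _](tmat_pair (smooth_snd X Y _) (smooth_fst X Y _)).
by rewrite tmat_fst tmat_snd mul_mx_row !mul_row_col !mulmx0 !mulmx1 addr0 add0r.
Qed.

(** States agree on the nose and parameters agree up to T^*(X x Y) ~ T^*X (x) T^*Y. The chain rule
    for the composite output and energy reproduces the two successive backward passes. *)
Lemma Tstar_comp A B C (c : erg_cell A B) (d : erg_cell B C) :
  ode_eq (Tstar_cell (erg_comp c d)) (ode_comp (Tstar_cell c) (Tstar_cell d)).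
Proof.
pose X := estate c; pose Y := estate d.
exists (diffeo_id (mprod X Y)), (lens_cotangent_merge X Y), (lens_cotangent_prod X Y).
split.
- exact/lens_inverse_sym/lens_cotangent_prod_inverse.
- apply: lens_eqP; first by case.
  move=> [x y] [[x' u] [y' v]] h.
  have [ex ey] : x = x' /\ y = y' by case: h.
  rewrite -ex -ey {ex ey h x' y'}.
  exists (tmerge (ereact c (x, u), ereact d (y, v))).
    apply: back_comp; first exact: back_cotangent_merge.
    by rewrite -sum_reactionE; exact: back_react_lens.
  apply: back_comp.
    apply: back_comp.
      by apply: back_tensor; exact: back_react_lens.
    by apply: back_maps; rewrite /= /prod_map /= !react_over.
  rewrite -[X in back _ _ _ X]tmap_id; apply: back_maps => /=.
  by rewrite !react_over.
- apply: lens_eqP; first by move=> [a [x y]].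
  move=> [a [x y]] [b xi] h; rewrite -[b]h {b h}.
  (* Backward pass through [d], with components on [B] and [Y]; then [c] receives [g1] and gives
     components on [A] and [X]. *)
  have [g1 [g2 eg]] :=
    cpairP (cpull (eout d) (eout c (a, x), y) xi +
      differential (energy d) (eout c (a, x), y)).
  have [d1 [d2 ed]] :=
    cpairP (cpull (eout c) (a, x) g1 + differential (energy c) (a, x)).
  exists ((a, d1), ((x, y), cpair d2 g2)).
    apply: (@back_Tstar_lens _ _ _ (erg_comp c d)).
    pose W := mprod A (mprod X Y).
    (* The composite has output [eout d] after [right], and its energy is [energy c] after [left]
       plus [energy d] after [right]. *)
    pose left (z : W) : mprod A X := (z.1, z.2.1).
    pose right (z : W) : mprod B Y := (eout c (left z), z.2.2).
    have sxy : smooth (snd : W -> mprod X Y) := smooth_snd A (mprod X Y).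
    have sa : smooth (fst : W -> A) := smooth_fst A (mprod X Y).
    have sx := smooth_comp sxy (smooth_fst X Y).
    have sy := smooth_comp sxy (smooth_snd X Y).
    have sl : smooth left := smooth_pair sa sx.
    have slc := smooth_comp sl (@eout_smooth _ _ _ c).
    have sr : smooth right := smooth_pair slc sy.
    pose w : W := (a, (x, y)).
    have e1 := cpull_comp w xi sr (@eout_smooth _ _ _ d).
    have e2 := differential_comp w sr (@energy_smooth _ _ _ d).
    have e3 := differential_comp w sl (@energy_smooth _ _ _ c).
    have e4 := differentialD w (smooth_comp sl (@energy_smooth _ _ _ c))
      (smooth_comp sr (@energy_smooth _ _ _ d)).
    apply: (etrans (congr2 +%R e1 (etrans e4 (congr2 +%R e3 e2)))).
    (* The terms pulled back along [right] are grouped first, to apply [eg]; this releases a term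
       along [left] that completes the sum in [ed]. *)
    rewrite addrCA -cpullD [X in cpull right _ X]eg.
    rewrite (cpull_pair _ _ _ slc sy) (cpull_comp _ _ sl (@eout_smooth _ _ _ c)).
    rewrite addrA [X in X + _]addrC -cpullD [X in cpull left _ X]ed.
    rewrite (cpull_pair _ _ _ sa sx) (cpull_comp _ _ sxy (smooth_fst X Y)).
    rewrite (cpull_comp _ _ sxy (smooth_snd X Y)) !cpull_fst !cpull_snd.
    by rewrite !(cpairD, addr0, add0r).
  apply: back_comp.
    apply: back_ode_comp; first exact: back_Tstar_lens eg.
    exact: back_Tstar_lens ed.
  by apply: back_tensor; [exact: back_id|exact: back_cotangent_merge].
Qed.

Lemma back_diffeo X Y (f : diffeo X Y) x (t : tangent Y) :
  f x = t.1 -> back (tangent_lens f) x t (tmap (dinv f) t).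
Proof. by move=> h; exists h. Qed.

(** In the naturality square the comparison comes last on one side and first on the other, so its
    unit parameter changes sides while T^*X and T^*Y are merged. *)
Definition lens_cotangent_swap X Y :
    lens (tensor (tensor (cot X) (cot Y)) lens_unit)
      (tensor lens_unit (cot (mprod X Y))) :=
  lens_comp (tensor_lens (lens_cotangent_prod X Y) (lens_id lens_unit))
    (lens_braid (cot (mprod X Y)) lens_unit).

Definition lens_cotangent_swap_inv X Y :
    lens (tensor lens_unit (cot (mprod X Y)))
      (tensor (tensor (cot X) (cot Y)) lens_unit) :=
  lens_comp (lens_braid lens_unit (cot (mprod X Y)))
    (tensor_lens (lens_cotangent_merge X Y) (lens_id lens_unit)).

Lemma back_cotangent_swap X Y (x : X) (y : Y) (o : R0) u v :
  back (lens_cotangent_swap X Y) ((x, y), o) (o, ((x, y), cpair u v))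
    (((x, u), (y, v)), o).
Proof.
apply: back_comp; first exact: back_maps.
by apply: back_tensor; [exact: back_cotangent_prod|exact: back_id].
Qed.

Lemma back_cotangent_swap_inv X Y (x : X) (y : Y) (o : R0) u v :
  back (lens_cotangent_swap_inv X Y) (o, (x, y)) (((x, u), (y, v)), o)
    (o, ((x, y), cpair u v)).
Proof.
apply: back_comp.
  by apply: back_tensor; [exact: back_cotangent_merge|exact: back_id].
exact: back_maps.
Qed.

Lemma lens_cotangent_swap_inverse X Y :
  lens_inverse (lens_cotangent_swap X Y) (lens_cotangent_swap_inv X Y).
Proof.
split; apply: lens_eqP.
- by case=> -[].
- move=> [[x y] o] [[[x' u] [y' v]] o'] h.
  have [ex ey eo] : [/\ x = x', y = y' & o = o'] by case: h.
  rewrite -ex -ey -eo {ex ey eo h x' y' o'}; exists (((x, u), (y, v)), o).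
    by apply: back_comp; [exact: back_cotangent_swap_inv|exact: back_cotangent_swap].
  exact: back_id.
- by case=> o -[].
- move=> [o [x y]] [o' [[x' y'] xi]] h.
  have [eo ex ey] : [/\ o = o', x = x' & y = y'] by case: h.
  have [u [v ->]] := cpairP xi.
  rewrite -ex -ey -eo {ex ey eo h x' y' o'}; exists (o, ((x, y), cpair u v)).
    by apply: back_comp; [exact: back_cotangent_swap|exact: back_cotangent_swap_inv].
  exact: back_id.
Qed.

(** Reactions act blockwise and energies add, so the covector of the product system consists of
    those of [c] and [d], with the inputs grouped before the states. *)
Lemma Tstar_natural A B A' B' (c : erg_cell A B) (d : erg_cell A' B') :
  ode_eq (ode_comp (ode_tensor (Tstar_cell c) (Tstar_cell d)) (Tstar_mu B B'))
    (ode_comp (Tstar_mu A A') (Tstar_cell (erg_tensor c d))).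
Proof.
pose X := estate c; pose Y := estate d.
exists (diffeo_pswap (mprod X Y) R0), (lens_cotangent_swap X Y),
  (lens_cotangent_swap_inv X Y).
split.
- exact: lens_cotangent_swap_inverse.
- apply: lens_eqP; first by case=> -[].
  move=> [[x y] o] [o' [[x' y'] xi]] h.
  have [eo ex ey] : [/\ o = o', x = x' & y = y'] by case: h.
  have [u [v ->]] := cpairP xi.
  rewrite -ex -ey -eo {ex ey eo h x' y' o' xi}.
  pose t : tangent (mprod X Y) := tmerge (ereact c (x, u), ereact d (y, v)).
  pose o0 : tangent R0 := (o, 0).
  exists (tmerge (t, o0)).
    apply: back_comp; first exact: back_cotangent_swap.
    apply: back_comp; last by apply: back_maps; rewrite /= /prod_map /= !react_over.
    apply: back_tensor; last exact: back_maps.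
    apply: back_comp; first by apply: back_tensor; exact: back_react_lens.
    by apply: back_maps; rewrite /= /prod_map /= !react_over.
  (* The states differ by a swap, so the common velocity is rewritten as the image under its
     differential of the pair in the other order. *)
  rewrite -[X in back _ _ _ X]tmap_pswap; apply: back_comp; last first.
    by apply: back_diffeo; rewrite /= !react_over.
  apply: back_comp; last by apply: back_maps; rewrite /= /prod_map /= !react_over.
  apply: back_tensor; first exact: back_maps.
  by rewrite /t -sum_reactionE; exact: (@back_react_lens _ _ _ (erg_tensor c d)).
- apply: lens_eqP.
    by move=> [[a a'] [[x y] o]]; exact: (erefl (eout c (a, x), eout d (a', y))).
  move=> [[a a'] [[x y] o]] [[b b'] xi] h.
  have [eb eb'] : eout c (a, x) = b /\ eout d (a', y) = b' by case: h.
  have [u [v ->]] := cpairP xi.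
  rewrite -eb -eb' {eb eb' h b b' xi}.
  have [g1 [g2 eg]] :=
    cpairP (cpull (eout c) (a, x) u + differential (energy c) (a, x)).
  have [d1 [d2 ed]] :=
    cpairP (cpull (eout d) (a', y) v + differential (energy d) (a', y)).
  exists (((a, g1), (a', d1)), (((x, g2), (y, d2)), o)).
    apply: back_ode_comp; first by apply: back_ode_of_lens; exact: back_cotangent_prod.
    by apply: back_ode_tensor; exact: back_Tstar_lens.
  have e : cpull (eout (erg_tensor c d)) ((a, a'), (x, y)) (cpair u v) +
      differential (energy (erg_tensor c d)) ((a, a'), (x, y)) =
      @cpair R (mprod A A') (mprod X Y) (cpair g1 d1) (cpair g2 d2).
    pose W := mprod (mprod A A') (mprod X Y); pose w : W := ((a, a'), (x, y)).
    pose left (z : W) : mprod A X := (z.1.1, z.2.1).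
    pose right (z : W) : mprod A' Y := (z.1.2, z.2.2).
    have s1 : smooth (fst : W -> mprod A A') := smooth_fst (mprod A A') (mprod X Y).
    have s2 : smooth (snd : W -> mprod X Y) := smooth_snd (mprod A A') (mprod X Y).
    have s11 := smooth_comp s1 (smooth_fst A A').
    have s12 := smooth_comp s1 (smooth_snd A A').
    have s21 := smooth_comp s2 (smooth_fst X Y).
    have s22 := smooth_comp s2 (smooth_snd X Y).
    have sl : smooth left := smooth_pair s11 s21.
    have sr : smooth right := smooth_pair s12 s22.
    have e1 := cpull_pair w u v (smooth_comp sl (@eout_smooth _ _ _ c))
      (smooth_comp sr (@eout_smooth _ _ _ d)).
    have e2 := differentialD w (smooth_comp sl (@energy_smooth _ _ _ c))
      (smooth_comp sr (@energy_smooth _ _ _ d)).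
    apply: (etrans (congr2 +%R e1 e2)).
    rewrite (cpull_comp _ _ sl (@eout_smooth _ _ _ c)).
    rewrite (cpull_comp _ _ sr (@eout_smooth _ _ _ d)).
    rewrite (differential_comp _ sl (@energy_smooth _ _ _ c)).
    rewrite (differential_comp _ sr (@energy_smooth _ _ _ d)).
    (* Collects the pulled-back covector and the differential of each system, where [eg] and [ed]
       apply. *)
    rewrite addrACA -!cpullD [X in cpull left _ X]eg [X in cpull right _ X]ed.
    rewrite (cpull_pair _ _ _ s11 s21) (cpull_pair _ _ _ s12 s22).
    rewrite (cpull_comp _ _ s1 (smooth_fst A A')) (cpull_comp _ _ s1 (smooth_snd A A')).
    rewrite (cpull_comp _ _ s2 (smooth_fst X Y)) (cpull_comp _ _ s2 (smooth_snd X Y)).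
    by rewrite !cpull_fst !cpull_snd !(cpairD, addr0, add0r).
  apply: back_comp.
    apply: back_ode_comp.
      exact: (@back_Tstar_lens _ _ _ (erg_tensor c d) _ _ _ _ _ e).
    by apply: back_ode_of_lens; exact: back_cotangent_prod.
  by apply: back_tensor; [exact: back_id|exact: back_cotangent_swap].
Qed.

End Functoriality.

Theorem theorem22 (R : realType) :
  @is_symmetric_monoidal_functor (OpenErg R) (OpenODE R)
    (@cotangent_lens_object R) (@Tstar_cell R) (@Tstar_mu R) (@Tstar_eps R).
Proof.
split.
- exact: Tstar_eq.
- exact: Tstar_id.
- exact: Tstar_comp.
- by move=> A B; exact: is_iso_ode_of_lens (lens_cotangent_prod_inverse A B).
- exact: is_iso_ode_of_lens (lens_cotangent_unit_inverse (R := R)).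
- exact: Tstar_natural.
- exact: Tstar_assoc.
- exact: Tstar_lunit.
- exact: Tstar_runit.
- exact: Tstar_braid.
Qed.
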